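(* Let $F=0$ be a hyperbolic equation with $F_s\ge 0$ and nondegenerate parametrization $i_F:\Sigma_7\to J^2(\mathbb{R}^2,\mathbb{R})$. Put $\lambda_+=\frac{F_s}{2}+\sqrt{\left|F_rF_t-\frac14F_s^2\right|}$ and $$\tilde I_1=\det\begin{pmatrix}F_r&F_s&F_t\\ \lambda_+&F_t&0\\ \left(\frac{F_t}{\lambda_+}\right)_r&\left(\frac{F_t}{\lambda_+}\right)_s&\left(\frac{F_t}{\lambda_+}\right)_t\end{pmatrix},\qquad \tilde I_2=\det\begin{pmatrix}0&F_r&\lambda_+\\ F_r&F_s&F_t\\ \left(\frac{F_r}{\lambda_+}\right)_r&\left(\frac{F_r}{\lambda_+}\right)_s&\left(\frac{F_r}{\lambda_+}\right)_t\end{pmatrix},$$ and let $I_i=i_F^*\tilde I_i$, $i=1,2$. Then the type of $F=0$ is determined as follows: (a) $F=0$ is of Monge--Ampère type if and only if $I_1=I_2=0$; (b) $F=0$ is of Goursat type if and only if exactly one of $I_1$, $I_2$ is zero; (c) $F=0$ is of generic type if and only if $I_1I_2\ne0$. Moreover, the following scaling property holds: if $\phi$ is a function on $J^2(\mathbb{R}^2,\mathbb{R})$ with $i_F^*\phi>0$ and $\hat F=\phi F$, then the corresponding functions $\hat I_1,\hat I_2$ for $\hat F$ (computed with $i_{\hat F}=i_F$) satisfy $\hat I_i=(i_F^*\phi)^2I_i$, $i=1,2$.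
   Context: All considerations are local and in the smooth category. $J^2(\mathbb{R}^2,\mathbb{R})$ has coordinates $(x,y,z,p,q,r,s,t)$ ($p=z_x,q=z_y,r=z_{xx},s=z_{xy},t=z_{yy}$); subscripts on functions denote partial derivatives in these coordinates. For a second order PDE $F(x,y,z,p,q,r,s,t)=0$, a nondegenerate parametrization is a smooth map $i_F:\Sigma_7\to J^2(\mathbb{R}^2,\mathbb{R})$ from an open set $\Sigma_7\subset\mathbb{R}^7$, of maximal rank $7$, whose image is the locus $\{F=0\}$ and is everywhere transverse to the fibres of the projection $J^2(\mathbb{R}^2,\mathbb{R})\to J^1(\mathbb{R}^2,\mathbb{R})$; one has $i_F^*\eta=0$ iff $\eta\wedge dF=0$ along the locus. Let $\theta^1=dz-p\,dx-q\,dy$, $\theta^2=dp-r\,dx-s\,dy$, $\theta^3=dq-s\,dx-t\,dy$ and let $I_F$ be the Pfaffian system on $\Sigma_7$ generated by $\omega^\alpha=i_F^*\theta^\alpha$, $\alpha=1,2,3$. Define a symmetric $C^\infty(\Sigma_7)$-bilinear form on $I_F$, up to scale, by $\langle\varphi,\psi\rangle_7\,\mathrm{Vol}=d\varphi\wedge d\psi\wedge\omega^1\wedge\omega^2\wedge\omega^3$, with $\mathrm{Vol}$ any volume form on $\Sigma_7$. The equation is hyperbolic if $i_F^*(F_rF_t-\frac14F_s^2)<0$; then $I_F$ contains exactly two rank-two maximally isotropic subsystems $M_1,M_2$ (labelling chosen). For a Pfaffian system $I$ on $\Sigma$, let $\mathcal{A}(I)=\{X\in\mathfrak{X}(\Sigma):X\in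 I^\perp,\ X\lrcorner dI\subset I\}$, $\mathcal{C}(I)=\mathcal{A}(I)^\perp$ ($\perp$ = annihilator), and $\mathrm{class}(I)=\operatorname{rank}\mathcal{C}(I)$. A hyperbolic equation (where $\mathrm{class}(M_i)\in\{6,7\}$) is of Monge--Ampère type (class 6-6) if $\mathrm{class}(M_1)=\mathrm{class}(M_2)=6$, of Goursat type (6-7) if $\{\mathrm{class}(M_1),\mathrm{class}(M_2)\}=\{6,7\}$, and of generic type (7-7) if $\mathrm{class}(M_1)=\mathrm{class}(M_2)=7$. *)

(* Defs.v *)
From HB Require Import structures.
From mathcomp Require Import all_boot all_order all_algebra all_fingroup.
From mathcomp Require Import all_classical all_reals all_analysis.

Set Implicit Arguments.
Unset Strict Implicit.
Unset Printing Implicit Defensive.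

Import Order.TTheory GRing.Theory Num.Theory.
Import numFieldNormedType.Exports.

Local Open Scope classical_set_scope.
Local Open Scope ring_scope.

Section Calculus.
Variables (R : realType) (n : nat).

Definition partial (j : 'I_n) (f : 'rV[R]_n -> R) : 'rV[R]_n -> R :=
  fun x => 'D_(delta_mx 0 j) f x.

(* Functions are total, but on an open [U] only their values on [U] matter.
   C^oo: every iterated partial derivative is (Frechet) differentiable. *)
Definition smooth_on (U : set 'rV[R]_n) (f : 'rV[R]_n -> R) : Prop :=
  forall (s : seq 'I_n) (x : 'rV[R]_n), U x ->
    differentiable (foldr partial f s) x.

Definition smooth_map_on (m : nat) (U : set 'rV[R]_n)
    (f : 'rV[R]_n -> 'rV[R]_m) : Prop :=
  forall j : 'I_m, smooth_on U (fun x => f x 0 j).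

(* A 1-form (or vector field) is given by its coefficients in the coordinate
   (co)frame; [evalf] is the pairing of a covector with a vector. *)
Definition evalf (c v : 'rV[R]_n) : R := (c *m v^T) 0 0.

(* Coefficients of the 2-form [d eta]: (d eta)(u, v) = u *m d1 eta x *m v^T. *)
Definition d1 (eta : 'rV[R]_n -> 'rV[R]_n) (x : 'rV[R]_n) : 'M[R]_n :=
  \matrix_(j, k) (partial j (fun y => eta y 0 k) x -
                  partial k (fun y => eta y 0 j) x).

Definition contract (X eta : 'rV[R]_n -> 'rV[R]_n) (x : 'rV[R]_n) : 'rV[R]_n :=
  X x *m d1 eta x.

(* A k-form at a point, as a function of the k vectors that are the rows of a
   matrix. *)
Definition kform (k : nat) := 'M[R]_(k, n) -> R.

Definition form1 (c : 'rV[R]_n) : kform 1 := fun A => evalf c A.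

Definition form2 (D : 'M[R]_n) : kform 2 :=
  fun A => (row ord0 A *m D *m (row ord_max A)^T) 0 0.

Definition wedge (k l : nat) (a : kform k) (b : kform l) : kform (k + l) :=
  fun A => ((k`! * l`!)%:R)^-1 *
    \sum_(s : 'S_(k + l)) (-1) ^+ s * a (usubmx (row_perm s A))
                                    * b (dsubmx (row_perm s A)).

End Calculus.

Section Pfaffian.
Variables (R : realType) (n : nat) (Sigma : set 'rV[R]_n).

Let oneform := 'rV[R]_n -> 'rV[R]_n.

Definition fiber (I : set oneform) (x : 'rV[R]_n) : set 'rV[R]_n :=
  [set eta x | eta in I].

(* The C^oo(Sigma)-module of all smooth sections over [Sigma] of a subbundle of
   rank k of the cotangent bundle: the first clause says that [I] contains every
   smooth 1-form with values in the fibres, the second that the fibres are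
   k-dimensional subspaces. *)
Definition pfaffian_system (k : nat) (I : set oneform) : Prop :=
  (forall eta, I eta <->
     smooth_map_on Sigma eta /\ (forall x, Sigma x -> fiber I x (eta x))) /\
  (forall x, Sigma x -> exists2 B : 'M[R]_n, \rank B = k &
     forall c, fiber I x c <-> (c <= B)%MS).

(* A(I): X in I^perp and X -| dI in I. *)
Definition cauchy_char (I : set oneform) : set ('rV[R]_n -> 'rV[R]_n) :=
  [set X | smooth_map_on Sigma X /\
     forall eta, I eta ->
       (forall x, Sigma x -> evalf (eta x) (X x) = 0) /\ I (contract X eta)].

(* The same two conditions, which are tensorial in X, on one tangent vector. *)
Definition cauchy_char_at (I : set oneform) (x : 'rV[R]_n) : set 'rV[R]_n :=
  [set v | forall eta, I eta ->
     evalf (eta x) v = 0 /\ fiber I x (v *m d1 eta x)].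

(* C(I) = A(I)^perp, fibrewise. *)
Definition cartan_system_at (I : set oneform) (x : 'rV[R]_n) : set 'rV[R]_n :=
  [set c | forall X, cauchy_char I X -> evalf c (X x) = 0].

(* class(I) = k.  A number class(I) presupposes that the Cauchy characteristic
   spaces form a distribution spanned by A(I) (first clause); without this, A(I)
   could not see a jump of these spaces on a nowhere dense set. *)
Definition class_is (I : set oneform) (k : nat) : Prop :=
  (forall x v, Sigma x -> cauchy_char_at I x v ->
     exists2 X, cauchy_char I X & X x = v) /\
  (forall x, Sigma x -> exists2 C : 'M[R]_n, \rank C = k &
     forall c, cartan_system_at I x c <-> (c <= C)%MS).

End Pfaffian.

Section SecondOrderPDE.
Variable R : realType.

(* J^2(R^2,R) = 'rV[R]_8 with coordinates (x, y, z, p, q, r, s, t). *)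
Definition jx : 'I_8 := @Ordinal 8 0 isT.
Definition jy : 'I_8 := @Ordinal 8 1 isT.
Definition jz : 'I_8 := @Ordinal 8 2 isT.
Definition jp : 'I_8 := @Ordinal 8 3 isT.
Definition jq : 'I_8 := @Ordinal 8 4 isT.
Definition jr : 'I_8 := @Ordinal 8 5 isT.
Definition js : 'I_8 := @Ordinal 8 6 isT.
Definition jt : 'I_8 := @Ordinal 8 7 isT.

Definition dcoord (j : 'I_8) : 'rV[R]_8 := delta_mx 0 j.

Definition theta1 (w : 'rV[R]_8) : 'rV[R]_8 :=
  dcoord jz - w 0 jp *: dcoord jx - w 0 jq *: dcoord jy.
Definition theta2 (w : 'rV[R]_8) : 'rV[R]_8 :=
  dcoord jp - w 0 jr *: dcoord jx - w 0 js *: dcoord jy.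
Definition theta3 (w : 'rV[R]_8) : 'rV[R]_8 :=
  dcoord jq - w 0 js *: dcoord jx - w 0 jt *: dcoord jy.

Definition pullback (i : 'rV[R]_7 -> 'rV[R]_8) (eta : 'rV[R]_8 -> 'rV[R]_8)
    (x : 'rV[R]_7) : 'rV[R]_7 :=
  eta (i x) *m ('J i x)^T.

(* Tangent space of the fibres of J^2 -> J^1. *)
Definition vertical : 'M[R]_(3, 8) :=
  col_mx (dcoord jr) (col_mx (dcoord js) (dcoord jt)).

(* [F] is a smooth function on the open part [U] of J^2. *)
Definition nondegenerate_parametrization (U : set 'rV[R]_8)
    (F : 'rV[R]_8 -> R) (Sigma : set 'rV[R]_7)
    (i : 'rV[R]_7 -> 'rV[R]_8) : Prop :=
  [/\ open Sigma /\ smooth_map_on Sigma i,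
      forall x, Sigma x -> \rank ('J i x) = 7%N,
      i @` Sigma = [set w | U w /\ F w = 0]
    & forall x, Sigma x -> row_full (col_mx ('J i x) vertical)].

Definition hyperbolic (F : 'rV[R]_8 -> R) (Sigma : set 'rV[R]_7)
    (i : 'rV[R]_7 -> 'rV[R]_8) : Prop :=
  forall x, Sigma x ->
    partial jr F (i x) * partial jt F (i x)
      - 4^-1 * partial js F (i x) ^+ 2 < 0.

Definition IF (Sigma : set 'rV[R]_7) (i : 'rV[R]_7 -> 'rV[R]_8) :
    set ('rV[R]_7 -> 'rV[R]_7) :=
  [set eta | smooth_map_on Sigma eta /\
     exists f1 f2 f3 : 'rV[R]_7 -> R,
       [/\ smooth_on Sigma f1, smooth_on Sigma f2, smooth_on Sigma f3
         & forall x, Sigma x -> eta x = f1 x *: pullback i theta1 x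
             + f2 x *: pullback i theta2 x + f3 x *: pullback i theta3 x]].

(* <phi, psi>_7 for Vol = dx^1 /\ ... /\ dx^7, i.e. the value of the 7-form on
   the standard basis; another Vol rescales it by a nowhere zero function. *)
Definition bracket7 (i : 'rV[R]_7 -> 'rV[R]_8)
    (phi psi : 'rV[R]_7 -> 'rV[R]_7) (x : 'rV[R]_7) : R :=
  wedge (wedge (wedge (wedge (form2 (d1 phi x)) (form2 (d1 psi x)))
    (form1 (pullback i theta1 x))) (form1 (pullback i theta2 x)))
    (form1 (pullback i theta3 x)) 1%:M.

Definition isotropic (Sigma : set 'rV[R]_7) (i : 'rV[R]_7 -> 'rV[R]_8)
    (M : set ('rV[R]_7 -> 'rV[R]_7)) : Prop :=
  M `<=` IF Sigma i /\
  forall phi psi, M phi -> M psi ->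
    forall x, Sigma x -> bracket7 i phi psi x = 0.

Definition max_isotropic2 (Sigma : set 'rV[R]_7) (i : 'rV[R]_7 -> 'rV[R]_8)
    (M : set ('rV[R]_7 -> 'rV[R]_7)) : Prop :=
  [/\ pfaffian_system Sigma 2 M, isotropic Sigma i M
    & forall k N, pfaffian_system Sigma k N -> isotropic Sigma i N ->
        M `<=` N -> N = M].

(* M1, M2 are the two rank-two maximally isotropic subsystems, in either
   order. *)
Definition isotropic_pair (Sigma : set 'rV[R]_7) (i : 'rV[R]_7 -> 'rV[R]_8)
    (M1 M2 : set ('rV[R]_7 -> 'rV[R]_7)) : Prop :=
  [/\ max_isotropic2 Sigma i M1, max_isotropic2 Sigma i M2, M1 <> M2
    & forall M, max_isotropic2 Sigma i M -> M = M1 \/ M = M2].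

Definition monge_ampere_type (Sigma : set 'rV[R]_7)
    (M1 M2 : set ('rV[R]_7 -> 'rV[R]_7)) : Prop :=
  class_is Sigma M1 6 /\ class_is Sigma M2 6.

Definition goursat_type (Sigma : set 'rV[R]_7)
    (M1 M2 : set ('rV[R]_7 -> 'rV[R]_7)) : Prop :=
  (class_is Sigma M1 6 /\ class_is Sigma M2 7) \/
  (class_is Sigma M1 7 /\ class_is Sigma M2 6).

Definition generic_type (Sigma : set 'rV[R]_7)
    (M1 M2 : set ('rV[R]_7 -> 'rV[R]_7)) : Prop :=
  class_is Sigma M1 7 /\ class_is Sigma M2 7.

Definition lambda_plus (F : 'rV[R]_8 -> R) (w : 'rV[R]_8) : R :=
  partial js F w / 2 +
  Num.sqrt `|partial jr F w * partial jt F w - 4^-1 * partial js F w ^+ 2|.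

Definition mx3 (rows : seq (seq R)) : 'M[R]_3 :=
  \matrix_(a < 3, b < 3) nth 0 (nth [::] rows a) b.

Definition I1tilde (F : 'rV[R]_8 -> R) (w : 'rV[R]_8) : R :=
  let mu := fun w' => partial jt F w' / lambda_plus F w' in
  \det (mx3 [:: [:: partial jr F w; partial js F w; partial jt F w];
                [:: lambda_plus F w; partial jt F w; 0];
                [:: partial jr mu w; partial js mu w; partial jt mu w]]).

Definition I2tilde (F : 'rV[R]_8 -> R) (w : 'rV[R]_8) : R :=
  let mu := fun w' => partial jr F w' / lambda_plus F w' in
  \det (mx3 [:: [:: 0; partial jr F w; lambda_plus F w];
                [:: partial jr F w; partial js F w; partial jt F w];
                [:: partial jr mu w; partial js mu w; partial jt mu w]]).

End SecondOrderPDE.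

(* Main.v *)
Require Import Defs.
From mathcomp Require Import all_boot all_order all_algebra all_fingroup.
From mathcomp Require Import all_classical all_reals all_analysis.
From mathcomp Require Import ring lra.

Import Order.TTheory GRing.Theory Num.Theory.
Import numFieldNormedType.Exports.

Local Open Scope classical_set_scope.
Local Open Scope ring_scope.

(** On the locus [F = 0] put [a = F_t / lambda_+] and [b = F_r / lambda_+].  Since
    [lambda_+] is a root of [X^2 - F_s X + F_r F_t], the restriction of [dF] to the
    fibres of [J^2 -> J^1] is [lambda_+ (b dr + (1 + a b) ds + a dt)], and
    hyperbolicity gives [a b <> 1].  The two maximally isotropic systems are
    [<w1, w2 + a w3>] and [<w1, b w2 + w3>], exchanged by the symmetry
    [x <-> y, p <-> q, r <-> t, a <-> b].

    Completing [A = w1, B = w2 + a w3, C = w3] to a coframe by [S = a dx - dy],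
    [T = dx - b dy], [P = dr + a ds], [Q = dt], one finds
    [dA = C /\ S] and [dB = tau /\ C - P' /\ T] modulo [A, B], where [P' = P + m S].
    Hence a Cauchy characteristic of [<A, B>] must be killed by
    [A, B, C, S, T, P], so it is a multiple of the vector [e] lying over
    [a^2 d/dr - a d/ds + d/dt], and it must also satisfy [tau(e) = da(e) = 0].
    Finally [I_1 = - lambda_+^2 da(e)], which decides between class 6 and class 7.
    Rescaling [F] by [phi] multiplies [lambda_+] by [phi] and does not change [a] on
    the locus, whence the scaling law, because [e] is tangent to the locus. *)

(** * Calculus *)

(** The class is prescribed at every point. Since all characteristic vectors at a point are
    multiples of one nowhere zero field [e], class 6 says that [da(e)] vanishes identically and
    class 7 that it vanishes nowhere. If [da(e)] has zeros without being zero, neither holds. The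
    fibre direction [(a^2, -a, 1)] is tangent to the locus because [a^2 b - a (1 + a b) + a = 0].
    Thus [da(e)] depends only on [a] along the locus, although the determinant is written with
    derivatives in all fibre directions of the jet space. The correction [m] comes from the [dx]
    coefficient of [dF]: as [S /\ T = (1 - a b) dx /\ dy], a multiple of [S] added to [P] absorbs it
    exactly when [1 - a b] can be inverted. The condition [F_s >= 0] makes [lambda_+] positive on
    the locus, so that [a] and [b] are both defined there. The exchange of [x] and [y] is carried
    out by stating the central result for eight arbitrary functions in place of the pulled back
    coordinates, and applying it to two orderings of them. *)

Section Smooth.
Set Implicit Arguments.
Unset Strict Implicit.
Variable R : realType.

(** Functions are total but controlled only on an open set, so differentiability has to depend on
    the germ alone: the first-order expansion of [f] at [x] is, near [x], also one of [g]. *)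
Lemma near_eq_differentiable (V W : normedModType R) (f g : V -> W) (x : V) :
  (\forall y \near x, f y = g y) -> differentiable f x -> differentiable g x.
Proof.
move=> fg df; have fgx : f x = g x := nbhs_singleton fg.
have [cdf dfx] := (diff_locallyP x f).1 df.
have key : g \o shift x = cst (g x) + 'd f x +o_ 0 id.
  apply/eqaddoP => e e0.
  have /eqaddoP/(_ e e0) := dfx.
  have fg0 : \forall h \near (0 : V), f (h + x) = g (h + x).
    by rewrite (near_shift x); near=> y; rewrite /= sub0r subrK; near: y.
  by apply: filterS2 fg0 => h fgh; rewrite !fctE /= -fgx -fgh.
apply/diff_locallyP; rewrite (diff_unique cdf key).
by split.
Unshelve. all: by end_near.
Qed.

(** * Differentiability of finite order *)

Section Ck.
Variables (n : nat).
Implicit Types (U : set 'rV[R]_n) (f g : 'rV[R]_n -> R) (x : 'rV[R]_n).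

Lemma partialE f x j : differentiable f x -> partial j f x = 'd f x (delta_mx 0 j).
Proof. by move=> df; rewrite /partial deriveE. Qed.

Lemma eq_partial U f g j x : open U -> (forall y, U y -> f y = g y) -> U x ->
  partial j f x = partial j g x.
Proof.
move=> oU fg Ux; rewrite /partial; apply: near_eq_derive.
by apply: filterS fg _; exact: open_nbhs_nbhs.
Qed.

Lemma partialD f g j x : differentiable f x -> differentiable g x ->
  partial j (fun y => f y + g y) x = partial j f x + partial j g x.
Proof. by move=> df dg; rewrite /partial (deriveD (f := f)) //; exact: diff_derivable. Qed.

Lemma partialM f g j x : differentiable f x -> differentiable g x ->
  partial j (fun y => f y * g y) x = f x * partial j g x + g x * partial j f x.
Proof. by move=> df dg; rewrite /partial (deriveM (f := f)) //; exact: diff_derivable. Qed.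

Lemma partial_cst (c : R) j x : partial j (fun _ => c) x = 0.
Proof. exact: derive_cst. Qed.

Lemma partialV f j x : differentiable f x -> f x != 0 ->
  partial j (fun y => (f y)^-1) x = - (f x * f x)^-1 * partial j f x.
Proof.
by move=> df fx0; rewrite /partial deriveV //; exact: diff_derivable.
Qed.

(** [Ck k] asks that the partial derivatives of order at most [k] be differentiable, so [k = 0] is
    differentiability. Bounding the order allows induction: the derivative of a product, an inverse,
    a root or a composite contains an expression of the same kind, needed at one order less. *)
Fixpoint Ck (k : nat) U f : Prop :=
  (forall x, U x -> differentiable f x) /\
  (if k is k'.+1 then forall j, Ck k' U (partial j f) else True).

Lemma smooth_onP U f : smooth_on U f <-> forall k, Ck k U f.
Proof.
split=> [sf k|H s x Ux].
  elim: k f sf => [|k IH] f sf; (split; first exact: (sf [::])) => // j.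
  by apply: IH => s x Ux; have := sf (rcons s j) x Ux; rewrite foldr_rcons.
elim/last_ind: s f H => [|s j IH] f H /=; first exact: (H 0).1.
by rewrite foldr_rcons; apply: IH => k; exact: (H k.+1).2.
Qed.

Lemma Ck_diff k U f x : Ck k U f -> U x -> differentiable f x.
Proof. by case: k => [|k] [+ _]; exact. Qed.

Lemma Ck_partial k U f j : Ck k.+1 U f -> Ck k U (partial j f).
Proof. by case=> _; exact. Qed.

Lemma Ck_eq k U f g : open U -> (forall y, U y -> f y = g y) -> Ck k U f -> Ck k U g.
Proof.
move=> oU; have dg f' g' : (forall y, U y -> f' y = g' y) ->
    (forall x, U x -> differentiable f' x) -> forall x, U x -> differentiable g' x.
  move=> fg df x Ux; apply: near_eq_differentiable (df x Ux).
  by apply: filterS fg _; exact: open_nbhs_nbhs.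
elim: k f g => [|k IH] f g fg [df pf]; (split; first exact: dg df) => // j.
by apply: IH (pf j) => y Uy; exact: eq_partial oU fg Uy.
Qed.

Lemma CkW k U f : Ck k.+1 U f -> Ck k U f.
Proof.
elim: k f => [|k IH] f [df pf]; (split; first exact: df) => // j.
exact: IH (pf j).
Qed.

Lemma Ck_cst k U (c : R) : Ck k U (fun _ => c).
Proof.
elim: k c => [|k IH] c; (split; first by move=> x _; exact: differentiable_cst) => // j.
rewrite (_ : partial j _ = fun _ => 0); first exact: IH.
by apply/funext => x; exact: partial_cst.
Qed.

Lemma CkD k U f g : open U -> Ck k U f -> Ck k U g -> Ck k U (fun y => f y + g y).
Proof.
move=> oU; elim: k f g => [|k IH] f g [df pf] [dg pg];
  (split; first by move=> x Ux; exact: differentiableD (df _ Ux) (dg _ Ux)) => // j.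
apply: Ck_eq oU _ (IH _ _ (pf j) (pg j)) => y Uy.
by rewrite partialD //; [exact: df|exact: dg].
Qed.

Lemma CkM k U f g : open U -> Ck k U f -> Ck k U g -> Ck k U (fun y => f y * g y).
Proof.
move=> oU; elim: k f g => [|k IH] f g Hf Hg.
  by split=> // x Ux; exact: differentiableM (Ck_diff Hf Ux) (Ck_diff Hg Ux).
split=> [x Ux|j]; first exact: differentiableM (Ck_diff Hf Ux) (Ck_diff Hg Ux).
apply: Ck_eq oU _ (CkD oU (IH _ _ (CkW Hf) (Hg.2 j)) (IH _ _ (CkW Hg) (Hf.2 j))) => y Uy.
by rewrite partialM //; [exact: Hf.1|exact: Hg.1].
Qed.

Lemma CkV k U f : open U -> (forall x, U x -> f x != 0) -> Ck k U f ->
  Ck k U (fun y => (f y)^-1).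
Proof.
move=> oU f0; elim: k => [|k IH] Hf.
  by split=> // x Ux; exact: differentiableV (Ck_diff Hf Ux) (f0 _ Ux).
split=> [x Ux|j]; first exact: differentiableV (Ck_diff Hf Ux) (f0 _ Ux).
have := CkM oU (CkM oU (Ck_cst k U (-1)) (CkM oU (IH (CkW Hf)) (IH (CkW Hf)))) (Hf.2 j).
apply: Ck_eq oU _ => y Uy; rewrite partialV ?f0 //; last exact: Hf.1.
by rewrite mulN1r invfM.
Qed.

Lemma differentiable_sqrt (y : R) : 0 < y -> differentiable (Num.sqrt : R -> R) y.
Proof.
move=> y0; apply/derivable1_diffP.
exact: (@ex_derive _ _ _ _ _ _ _ (is_derive1_sqrt y0)).
Qed.

Lemma partial_sqrt f j x : differentiable f x -> 0 < f x ->
  partial j (fun y => Num.sqrt (f y)) x = (2 * Num.sqrt (f x))^-1 * partial j f x.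
Proof.
move=> df fx0; have ds := differentiable_sqrt fx0.
rewrite !partialE //; last exact: (@differentiable_comp _ _ _ _ f Num.sqrt).
rewrite (@diff_comp _ _ _ _ f Num.sqrt) //= diff1E //= derive1E derive_sqrt //.
exact: mulrC.
Qed.

Lemma Ck_sqrt k U f : open U -> (forall x, U x -> 0 < f x) -> Ck k U f ->
  Ck k U (fun y => Num.sqrt (f y)).
Proof.
move=> oU f0; have dsq x : U x -> differentiable f x ->
    differentiable (fun y => Num.sqrt (f y)) x.
  move=> Ux df; apply: (@differentiable_comp _ _ _ _ f Num.sqrt) => //.
  exact: differentiable_sqrt (f0 _ Ux).
elim: k => [|k IH] Hf; (split; first by move=> x Ux; exact: dsq Ux (Ck_diff Hf Ux)) => // j.
have H := CkM oU (Ck_cst k U 2) (IH (CkW Hf)).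
have H0 x : U x -> 2 * Num.sqrt (f x) != 0.
  by move=> Ux; rewrite mulf_neq0 ?pnatr_eq0// gt_eqF // sqrtr_gt0 f0.
apply: Ck_eq oU _ (CkM oU (CkV oU H0 H) (Hf.2 j)) => y Uy.
by rewrite partial_sqrt ?f0 //; exact: Hf.1.
Qed.

End Ck.

Lemma diff_partial n (f : 'rV[R]_n -> R) x (v : 'rV[R]_n) : differentiable f x ->
  'd f x v = \sum_j v 0 j * partial j f x.
Proof.
move=> df; rewrite {1}(row_sum_delta v) raddf_sum; apply: eq_bigr => j _.
by rewrite partialE //; exact: linearZ.
Qed.

Lemma differentiable_row m n (i : 'rV[R]_m -> 'rV[R]_n) x :
  (forall j, differentiable (fun y => i y 0 j) x) -> differentiable i x.
Proof.
move=> di; rewrite (_ : i = \sum_j (fun y => i y 0 j *: (delta_mx 0 j : 'rV[R]_n))).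
  by apply: differentiable_sum => j; exact: differentiableZl.
by apply/funext => y; rewrite fct_sumE -row_sum_delta.
Qed.

Lemma jacobianE m n (i : 'rV[R]_m -> 'rV[R]_n) x k j : differentiable i x ->
  'J i x k j = partial k (fun y => i y 0 j) x.
Proof.
move=> di; have dk := diff_derivable (v := delta_mx 0 k) di.
rewrite /partial; transitivity ('D_(delta_mx 0 k) i x 0 j).
  by rewrite deriveEjacobian // -rowE [RHS]mxE.
by rewrite derive_mx // mxE.
Qed.

(** * Chain rule and composition with smooth maps *)

Section Comp.
Variables (m n : nat) (V : set 'rV[R]_m) (U : set 'rV[R]_n) (i : 'rV[R]_m -> 'rV[R]_n).
Hypotheses (oV : open V) (iVU : forall x, V x -> U (i x)).

Lemma partial_comp (f : 'rV[R]_n -> R) k x :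
  (forall j, differentiable (fun y => i y 0 j) x) -> differentiable f (i x) ->
  partial k (fun y => f (i y)) x =
  \sum_j partial k (fun y => i y 0 j) x * partial j f (i x).
Proof.
move=> di df; have dix := differentiable_row di.
rewrite partialE; last exact: (@differentiable_comp _ _ _ _ i f).
rewrite (@diff_comp _ _ _ _ i f) //= diff_partial //; apply: eq_bigr => j _.
by rewrite -jacobianE // /jacobian mxE.
Qed.

Lemma Ck_sum k (I : Type) (r : seq I) (P : pred I) (F : I -> 'rV[R]_m -> R) :
  (forall j, P j -> Ck k V (F j)) -> Ck k V (fun y => \sum_(j <- r | P j) F j y).
Proof.
move=> H; elim: r => [|j r IH].
  by apply: Ck_eq oV _ (Ck_cst k V 0) => y _; rewrite big_nil.
case Pj : (P j); last by apply: Ck_eq oV _ IH => y _; rewrite big_cons Pj.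
by apply: Ck_eq oV _ (CkD oV (H j Pj) IH) => y _; rewrite big_cons Pj.
Qed.

Lemma Ck_prod k (I : Type) (r : seq I) (F : I -> 'rV[R]_m -> R) :
  (forall j, Ck k V (F j)) -> Ck k V (fun y => \prod_(j <- r) F j y).
Proof.
move=> H; elim: r => [|j r IH].
  by apply: Ck_eq oV _ (Ck_cst k V 1) => y _; rewrite big_nil.
by apply: Ck_eq oV _ (CkM oV (H j) IH) => y _; rewrite big_cons.
Qed.

Lemma Ck_comp k f : (forall j, Ck k V (fun y => i y 0 j)) -> Ck k U f ->
  Ck k V (fun y => f (i y)).
Proof.
elim: k f => [|k IH] f Hi Hf.
all: have df x : V x -> differentiable (fun y => f (i y)) x
  by move=> Vx; apply: (@differentiable_comp _ _ _ _ i f);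
    [apply: differentiable_row => j; exact: Ck_diff (Hi j) Vx
    |exact: Ck_diff Hf (iVU Vx)].
all: split=> //.
move=> j.
have : Ck k V (fun y => \sum_l partial j (fun y => i y 0 l) y * partial l f (i y)).
  apply: Ck_sum => l _; apply: CkM => //; first exact: (Hi l).2.
  by apply: IH (Hf.2 l) => l'; exact: CkW (Hi l').
apply: Ck_eq oV _ => y Vy; rewrite partial_comp // => [l|].
  exact: Ck_diff (Hi l) Vy.
exact: Ck_diff Hf (iVU Vy).
Qed.

End Comp.

(** * Symmetry of second derivatives *)

Section Schwarz.
Variable n : nat.
Implicit Types (x u v : 'rV[R]_n) (f : 'rV[R]_n -> R).

Lemma is_derive_line f x u (s : R) : differentiable f (x + s *: u) ->
  is_derive s 1 (fun s => f (x + s *: u)) ('D_u f (x + s *: u)).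
Proof.
move=> df; pose l := fun s : R => x + s *: u.
have dl : is_diff s l (fun t : R => t *: u).
  by apply: is_diff_eq; rewrite add0r.
have dc : differentiable (f \o l) s by exact: differentiable_comp.
have -> : 'D_u f (x + s *: u) = 'D_1 (f \o l) s.
  rewrite !deriveE // (@diff_comp _ _ _ _ l f) //=.
  by rewrite diff_val scale1r.
exact/derivableP/diff_derivable.
Qed.

(** The second difference is the increment in [s] of [f (x + h v + s u) - f (x + s u)]. The mean
    value theorem in the direction [u] turns it into an increment of ['D_u f] in the direction [v],
    to which the theorem applies again. *)
Lemma double_MVT f x u v (h : R) : 0 < h ->
  (forall s t, 0 <= s <= h -> 0 <= t <= h ->
     differentiable f (x + s *: u + t *: v) /\
     differentiable ('D_u f) (x + s *: u + t *: v)) ->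
  exists c d, [/\ 0 <= c <= h, 0 <= d <= h &
    f (x + h *: u + h *: v) - f (x + h *: u) - f (x + h *: v) + f x
      = 'D_v ('D_u f) (x + c *: u + d *: v) * h * h].
Proof.
move=> h0 H; have h00 : 0 <= (0 : R) <= h by rewrite lexx ltW.
have hh : 0 <= h <= h by rewrite lexx ltW.
have ioo (c : R) : c \in `]0, h[ -> 0 <= c <= h.
  by rewrite in_itv /= => /andP[/ltW-> /ltW->].
pose G s := f (x + h *: v + s *: u) - f (x + s *: u).
pose G' s := 'D_u f (x + h *: v + s *: u) - 'D_u f (x + s *: u).
have dG s : 0 <= s <= h -> is_derive s 1 G (G' s).
  move=> sh; have [d1 _] := H s h sh hh; have [d2 _] := H s 0 sh h00.
  rewrite scale0r addr0 in d2; rewrite addrAC in d1.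
  have [i1 i2] := (is_derive_line d1, is_derive_line d2).
  exact: is_deriveB.
have [|c /ioo ch Gc] := @MVT _ G G' 0 h h0 (fun s sh => dG s (ioo s sh)).
  apply: derivable_within_continuous => s; rewrite in_itv => /dG ds.
  exact: ex_derive.
pose L t := 'D_u f (x + c *: u + t *: v).
have dL t : 0 <= t <= h -> is_derive t 1 L ('D_v ('D_u f) (x + c *: u + t *: v)).
  by move=> th; have [_ d2] := H c t ch th; exact: is_derive_line.
have [|d /ioo dh Lc] := @MVT _ L _ 0 h h0 (fun s sh => dL s (ioo s sh)).
  apply: derivable_within_continuous => s; rewrite in_itv => /dL ds.
  exact: ex_derive.
exists c, d; split => //.
move: Gc Lc; rewrite /G /G' /L !scale0r !addr0 subr0 => Gc <-.
rewrite (addrAC x (c *: u)) -Gc (addrAC x (h *: v)).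
by rewrite opprB addrA [RHS]addrAC.
Qed.

(** The second difference is symmetric in its two directions, so [double_MVT] makes the two mixed
    derivatives agree at two points arbitrarily close to [x]. By continuity they cannot differ at
    [x]. *)
Lemma partialC (U : set 'rV[R]_n) f j k x : open U -> Ck 2 U f -> U x ->
  partial j (partial k f) x = partial k (partial j f) x.
Proof.
move=> oU Hf Ux; apply/eqP/negPn/negP => ne.
have cA : {for x, continuous (partial j (partial k f))}.
  exact: differentiable_continuous (Ck_diff (Ck_partial j (Ck_partial k Hf)) Ux).
have cB : {for x, continuous (partial k (partial j f))}.
  exact: differentiable_continuous (Ck_diff (Ck_partial k (Ck_partial j Hf)) Ux).
pose e := `|partial j (partial k f) x - partial k (partial j f) x| / 2.
have e0 : 0 < e by rewrite divr_gt0 // normr_gt0 subr_eq0.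
have nU : \forall y \near x, U y by exact: open_nbhs_nbhs.
move/cvgrPdist_lt: cA => /(_ e e0) nA; move/cvgrPdist_lt: cB => /(_ e e0) nB.
have [r r0 Hr] := (nbhs_normP _ _).1 (filterI nU (filterI nA nB)).
(* Two steps of length at most [r / 3] along coordinate vectors stay inside the ball of radius
   [r]. *)
pose h := r / 3; have h0 : 0 < h by rewrite divr_gt0.
have In (s t : R) (u v : 'I_n) : 0 <= s <= h -> 0 <= t <= h ->
    ball_ Num.norm x r (x + s *: delta_mx 0 u + t *: delta_mx 0 v).
  move=> /andP[s0 sh] /andP[t0 th]; rewrite /ball_ /= -addrA opprD addNKr normrN.
  have nd (l : 'I_n) : `|delta_mx 0 l : 'rV[R]_n| <= 1.
    rewrite [leLHS]/Num.Def.normr/= mx_normrE; apply: bigmax_le => // -[a b] _ /=.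
    by rewrite mxE; case: (_ && _); rewrite ?normr1 ?normr0.
  apply: le_lt_trans (ler_normD _ _) _; rewrite !normrZ (ger0_norm s0) (ger0_norm t0).
  apply: (@le_lt_trans _ _ (h + h)).
    by rewrite lerD // -[leRHS]mulr1 ler_pM.
  by move: r0; clear; rewrite /h /=; lra.
have D (u v : 'I_n) (s t : R) : 0 <= s <= h -> 0 <= t <= h ->
     differentiable f (x + s *: delta_mx 0 u + t *: delta_mx 0 v) /\
     differentiable (partial u f) (x + s *: delta_mx 0 u + t *: delta_mx 0 v).
  move=> sh th; have [Uy _] := Hr _ (In s t u v sh th).
  by split; [exact: Ck_diff Hf Uy|exact: Ck_diff (Ck_partial u Hf) Uy].
have [c [d [ch dh E1]]] := double_MVT h0 (D j k).
have [c' [d' [c'h d'h E2]]] := double_MVT h0 (D k j).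
have [_ [_ /= B1]] := Hr _ (In _ _ j k ch dh).
have [_ [/= A1 _]] := Hr _ (In _ _ k j c'h d'h).
have E : partial k (partial j f) (x + c *: delta_mx 0 j + d *: delta_mx 0 k) =
         partial j (partial k f) (x + c' *: delta_mx 0 k + d' *: delta_mx 0 j).
  have hn0 : h != 0 by rewrite gt_eqF.
  apply: (mulIf hn0); apply: (mulIf hn0).
  rewrite /partial; etransitivity; [exact: esym E1|etransitivity; [|exact: E2]].
  by congr (_ + _); rewrite [LHS]addrAC (addrAC x (h *: delta_mx 0 k)).
move: A1 B1; rewrite E; move: (partial j _ (_ + _)) => p.
have := ler_distD p (partial j (partial k f) x) (partial k (partial j f) x).
rewrite (distrC p) -/e => H A1 B1; have := le_lt_trans H (ltrD A1 B1).
by rewrite -splitr ltxx.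
Qed.

End Schwarz.
End Smooth.

(** * The form with values in 7-forms *)

Section Wedge.
Set Implicit Arguments.
Unset Strict Implicit.
Variables (R : realType) (n : nat).

Definition alternation (k : nat) (T : 'M[R]_(k, n) -> R) (A : 'M[R]_(k, n)) : R :=
  \sum_(s : 'S_k) (-1) ^+ s * T (row_perm s A).

Definition extend_perm (k : nat) (u : 'S_k) : 'S_(k + 1) :=
  cast_perm (esym (addn1 k)) (lift_perm ord_max ord_max u).

Lemma odd_cast_perm m k (e : m = k) (u : 'S_m) :
  odd_perm (cast_perm e u) = odd_perm u.
Proof. by subst k; rewrite cast_perm_id. Qed.

Lemma odd_extend_perm k (u : 'S_k) : odd_perm (extend_perm u) = odd_perm u.
Proof. by rewrite /extend_perm odd_cast_perm odd_lift_perm addbb. Qed.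

Lemma extend_perm_lshift k (u : 'S_k) i :
  extend_perm u (lshift 1 i) = lshift 1 (u i).
Proof.
apply: val_inj; rewrite /extend_perm cast_permE /=.
have -> : cast_ord (esym (esym (addn1 k))) (lshift 1 i) = lift ord_max i.
  by apply: val_inj; rewrite /= /bump leqNgt ltn_ord.
by rewrite lift_perm_lift /= /bump leqNgt ltn_ord.
Qed.

Lemma extend_perm_rshift k (u : 'S_k) i :
  extend_perm u (rshift k i) = rshift k i.
Proof.
apply: val_inj; rewrite /extend_perm cast_permE /=.
have -> : cast_ord (esym (esym (addn1 k))) (rshift k i) = ord_max.
  by apply: val_inj; rewrite /= ord1 addn0.
by rewrite lift_perm_id /= ord1 addn0.
Qed.

(** If [a] is already an alternation, each inner permutation [u] is absorbed by the substitution of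
    [extend_perm u * s] for [s]. The inner sum thus contributes a factor [k!], which cancels the
    normalisation of [wedge]; iterated products with 1-forms become a single alternation. *)
Lemma wedge_alternation_form1 k (T : 'M[R]_(k, n) -> R) (c : R) (a : kform R n k) w A :
  (forall B, a B = c * alternation T B) ->
  wedge a (form1 w) A =
  c * alternation (fun B : 'M[R]_(k + 1, n) => T (usubmx B) * evalf w (dsubmx B)) A.
Proof.
move=> aE; rewrite /wedge /alternation.
pose G (s : 'S_(k + 1)) := (-1) ^+ s * (T (usubmx (row_perm s A)) * evalf w (dsubmx (row_perm s A))).
have -> : \sum_(s : 'S_(k + 1)) (-1) ^+ s * a (usubmx (row_perm s A)) * form1 w (dsubmx (row_perm s A))
    = c * \sum_(u : 'S_k) \sum_(s : 'S_(k + 1)) G s.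
  transitivity (c * \sum_(u : 'S_k) \sum_(s : 'S_(k + 1)) G (extend_perm u * s)%g); last first.
    congr (_ * _); apply: eq_bigr => u _.
    by rewrite [RHS](reindex_inj (mulgI (extend_perm u))).
  rewrite exchange_big mulr_sumr; apply: eq_bigr => s _.
  rewrite aE /alternation mulrCA -!mulrA; congr (_ * _).
  rewrite mulr_suml mulr_sumr; apply: eq_bigr => u _.
  rewrite /G odd_permM signr_addb odd_extend_perm.
  have -> : usubmx (row_perm (extend_perm u * s)%g A) = row_perm u (usubmx (row_perm s A)).
    by apply/matrixP => i j; rewrite !mxE permM extend_perm_lshift.
  have -> : dsubmx (row_perm (extend_perm u * s)%g A) = dsubmx (row_perm s A).
    by apply/matrixP => i j; rewrite !mxE permM extend_perm_rshift.
  by rewrite /form1 -!mulrA mulrCA.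
rewrite sumr_const card_Sn (_ : 1`! = 1)%N // muln1 -[(\sum_s _) *+ _]mulr_natl mulrCA mulKf //.
Qed.

Definition rank1 (a b : 'rV[R]_n) : 'M[R]_n := a^T *m b.
(** The matrix of the 2-form [a /\ b] in the convention of [d1]. *)
Definition wedge1 (a b : 'rV[R]_n) : 'M[R]_n :=
  \matrix_(i, j) (a 0 i * b 0 j - b 0 i * a 0 j).

Lemma wedge1_rank1 a b : wedge1 a b = rank1 a b - rank1 b a.
Proof. by apply/matrixP => i j; rewrite !mxE !big_ord1 !mxE. Qed.

Lemma form2_rank1 a b (A : 'M[R]_(2, n)) :
  form2 (rank1 a b) A = evalf a (row ord0 A) * evalf b (row ord_max A).
Proof.
rewrite /form2 /rank1 /evalf mulmxA -!mulmxA mulmxA -(trmxK (row ord0 A *m _)) trmx_mul trmxK.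
by rewrite -[LHS]/((_ *m _) 0 0) mxE big_ord1 mxE.
Qed.

End Wedge.

(** * The 7-form as a determinant *)

Section Volume.
Set Implicit Arguments.
Unset Strict Implicit.
Variable R : realType.
Implicit Types (a b c d w : 'rV[R]_7) (D E : 'M[R]_7).

Definition vol7 D E w1 w2 w3 : R :=
  wedge (wedge (wedge (wedge (form2 D) (form2 E)) (form1 w1)) (form1 w2)) (form1 w3) 1%:M.

Definition flat7 D E w1 w2 w3 (B : 'M[R]_(2 + 2 + 1 + 1 + 1, 7)) : R :=
  form2 D (usubmx (usubmx (usubmx (usubmx B)))) *
  form2 E (dsubmx (usubmx (usubmx (usubmx B)))) *
  evalf w1 (dsubmx (usubmx (usubmx B))) * evalf w2 (dsubmx (usubmx B)) *
  evalf w3 (dsubmx B).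

(** The factor is [1 / (2! 2!)], from the product of the two 2-forms; the three products with
    1-forms leave no factor behind. *)
Lemma vol7E D E w1 w2 w3 :
  vol7 D E w1 w2 w3 = 4^-1 * alternation (flat7 D E w1 w2 w3) 1%:M.
Proof.
pose T4 (B : 'M[R]_(2 + 2, 7)) := form2 D (usubmx B) * form2 E (dsubmx B).
pose T5 (B : 'M[R]_(2 + 2 + 1, 7)) := T4 (usubmx B) * evalf w1 (dsubmx B).
pose T6 (B : 'M[R]_(2 + 2 + 1 + 1, 7)) := T5 (usubmx B) * evalf w2 (dsubmx B).
apply: (wedge_alternation_form1 (T := T6)) => B3.
apply: (wedge_alternation_form1 (T := T5)) => B2.
apply: (wedge_alternation_form1 (T := T4)) => B1.
rewrite /wedge (_ : 2`! * 2`! = 4)%N //.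
by congr (_ * _); apply: eq_bigr => s _; rewrite mulrA.
Qed.

Definition rows7 (l : seq 'rV[R]_7) : 'M[R]_7 := \matrix_(i < 7, j < 7) nth 0 l i 0 j.

Lemma evalf_delta n (u : 'rV[R]_n) v k : v = delta_mx 0 k -> evalf u v = u 0 k.
Proof.
move=> ->; rewrite /evalf trmx_delta mxE (bigD1 k) //= mxE !eqxx mulr1 big1 ?addr0 // => j jk.
by rewrite mxE (negPf jk) mulr0.
Qed.

(** On the standard basis, the alternation of a product of seven 1-forms is the Leibniz expansion of
    a determinant. *)
Lemma vol7_rank1 a b c d w1 w2 w3 :
  vol7 (rank1 a b) (rank1 c d) w1 w2 w3 = 4^-1 * \det (rows7 [:: a; b; c; d; w1; w2; w3]).
Proof.
rewrite vol7E; congr (_ * _); apply: eq_bigr => s _; congr (_ * _).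
rewrite /flat7 !form2_rank1.
have ev u (v : 'rV[R]_7) (k : 'I_7) : (forall j, v 0 j = (s k == j)%:R) ->
    evalf u v = u 0 (s k).
  by move=> vE; apply: evalf_delta; apply/rowP => j; rewrite vE !mxE eqxx eq_sym.
rewrite !big_ord_recl big_ord0 !mxE mulr1 /= !mulrA.
by do ?congr (_ * _); apply: ev => j; rewrite !mxE; congr ((s _ == _)%:R); apply: val_inj.
Qed.

Lemma form2D D D' A : form2 (D + D') A = form2 D A + form2 D' A.
Proof. by rewrite /form2 mulmxDr mulmxDl mxE. Qed.

Lemma form2Z k D A : form2 (k *: D) A = k * form2 D A.
Proof. by rewrite /form2 -scalemxAr -scalemxAl mxE. Qed.

Lemma vol7Dl D D' E w1 w2 w3 :
  vol7 (D + D') E w1 w2 w3 = vol7 D E w1 w2 w3 + vol7 D' E w1 w2 w3.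
Proof.
rewrite !vol7E -mulrDr -big_split; congr (_ * _); apply: eq_bigr => s _.
by rewrite /flat7 form2D !mulrDl mulrDr.
Qed.

Lemma vol7Dr D E E' w1 w2 w3 :
  vol7 D (E + E') w1 w2 w3 = vol7 D E w1 w2 w3 + vol7 D E' w1 w2 w3.
Proof.
rewrite !vol7E -mulrDr -big_split; congr (_ * _); apply: eq_bigr => s _.
by rewrite /flat7 form2D !(mulrDl, mulrDr).
Qed.

Lemma vol7Zl k D E w1 w2 w3 : vol7 (k *: D) E w1 w2 w3 = k * vol7 D E w1 w2 w3.
Proof.
rewrite !vol7E mulrCA; congr (_ * _); rewrite mulr_sumr; apply: eq_bigr => s _.
by rewrite [RHS]mulrCA /flat7 form2Z -!mulrA.
Qed.

Lemma vol7Zr k D E w1 w2 w3 : vol7 D (k *: E) w1 w2 w3 = k * vol7 D E w1 w2 w3.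
Proof.
rewrite !vol7E mulrCA; congr (_ * _); rewrite mulr_sumr; apply: eq_bigr => s _.
rewrite [RHS]mulrCA /flat7 form2Z; congr (_ * _); rewrite -!mulrA.
by rewrite mulrCA.
Qed.

Lemma det_rows7_swap l l' (i j : 'I_7) : i != j ->
  (forall k : 'I_7, nth 0 l' k = nth 0 l (tperm i j k)) ->
  \det (rows7 l') = - \det (rows7 l).
Proof.
move=> ij H; transitivity (\det (row_perm (tperm i j) (rows7 l))).
  by congr (\det _); apply/matrixP => a b; rewrite !mxE H.
by rewrite row_permE detM det_perm odd_tperm ij mulN1r.
Qed.

Lemma det_rows7_0 l (v : 'rV[R]_7) : v != 0 ->
  \sum_(i < 7) v 0 i *: nth 0 l i = 0 -> \det (rows7 l) = 0.
Proof.
move=> v0 H; apply/eqP/det0P; exists v => //.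
rewrite mulmx_sum_row -[RHS]H; apply: eq_bigr => i _; congr (_ *: _).
by apply/rowP => j; rewrite !mxE.
Qed.

Lemma det_rows7_neq0 l :
  (forall u, (forall i : 'I_7, evalf (nth 0 l i) u = 0) -> u = 0) -> \det (rows7 l) != 0.
Proof.
move=> H; rewrite -det_tr; apply/negP => /det0P[u /negP u0 uM]; apply: u0.
apply/eqP/H => i; have /rowP/(_ i) := uM; rewrite !mxE => uMi.
rewrite /evalf mxE -[RHS]uMi; apply: eq_bigr => j _; rewrite !mxE; exact: mulrC.
Qed.

(** Each [wedge1] is a difference of two rank-one forms. The four resulting determinants agree up to
    the signs of row swaps, and together they cancel the factor [1 / 4]. *)
Lemma vol7_wedge1 a b c d w1 w2 w3 :
  vol7 (wedge1 a b) (wedge1 c d) w1 w2 w3 = \det (rows7 [:: a; b; c; d; w1; w2; w3]).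
Proof.
have sw1 x y z t : \det (rows7 [:: y; x; z; t; w1; w2; w3]) = - \det (rows7 [:: x; y; z; t; w1; w2; w3]).
  apply: (@det_rows7_swap _ _ (@Ordinal 7 0 isT) (@Ordinal 7 1 isT)) => //.
  by case=> -[|[|[|[|[|[|[|?]]]]]]] // ?; rewrite permE.
have sw2 x y z t : \det (rows7 [:: x; y; t; z; w1; w2; w3]) = - \det (rows7 [:: x; y; z; t; w1; w2; w3]).
  apply: (@det_rows7_swap _ _ (@Ordinal 7 2 isT) (@Ordinal 7 3 isT)) => //.
  by case=> -[|[|[|[|[|[|[|?]]]]]]] // ?; rewrite permE.
rewrite !wedge1_rank1 -![- rank1 _ _]scaleN1r !vol7Dl !vol7Dr !vol7Zl !vol7Zr !vol7_rank1.
rewrite (sw1 a b c d) (sw2 b a c d) (sw1 a b c d) (sw2 a b c d).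
lra.
Qed.

Lemma rank1_sum E : E = \sum_i \sum_j E i j *: rank1 (delta_mx 0 i) (delta_mx 0 j).
Proof.
rewrite {1}(matrix_sum_delta E); apply: eq_bigr => i _; apply: eq_bigr => j _.
by rewrite /rank1 trmx_delta mul_delta_mx.
Qed.

Lemma vol7_eq0r D w1 w2 w3 : (forall c d, vol7 D (rank1 c d) w1 w2 w3 = 0) ->
  forall E, vol7 D E w1 w2 w3 = 0.
Proof.
move=> H E; have V0 : vol7 D 0 w1 w2 w3 = 0 by rewrite -(scale0r 0) vol7Zr mul0r.
have VD x y : vol7 D (x + y) w1 w2 w3 = _ := vol7Dr D x y w1 w2 w3.
rewrite (rank1_sum E).
rewrite (big_morph (fun E => vol7 D E w1 w2 w3) VD V0) big1 // => i _.
rewrite (big_morph (fun E => vol7 D E w1 w2 w3) VD V0) big1 // => j _.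
by rewrite vol7Zr H mulr0.
Qed.

Lemma vol7_eq0l E w1 w2 w3 : (forall a b, vol7 (rank1 a b) E w1 w2 w3 = 0) ->
  forall D, vol7 D E w1 w2 w3 = 0.
Proof.
move=> H D; have V0 : vol7 0 E w1 w2 w3 = 0 by rewrite -(scale0r 0) vol7Zl mul0r.
have VD x y : vol7 (x + y) E w1 w2 w3 = _ := vol7Dl x y E w1 w2 w3.
rewrite (rank1_sum D).
rewrite (big_morph (fun D => vol7 D E w1 w2 w3) VD V0) big1 // => i _.
rewrite (big_morph (fun D => vol7 D E w1 w2 w3) VD V0) big1 // => j _.
by rewrite vol7Zl H mulr0.
Qed.

(** [cs] lists the coefficients of a linear relation between the rows; those past its end count as
    0, which keeps the lists short. *)
Lemma det_rows7_dep (l : seq 'rV[R]_7) (cs : seq R) : has (fun z : R => z != 0) (take 7 cs) ->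
  \sum_(i < 7) cs`_i *: nth 0 l i = 0 -> \det (rows7 l) = 0.
Proof.
move=> /(has_nthP 0)[k]; rewrite size_take_min leq_min => /andP[k7 _]; rewrite nth_take // => ck H.
apply: (@det_rows7_0 _ (\row_i cs`_i)).
  by apply/eqP => /rowP/(_ (Ordinal k7)); rewrite !mxE /=; apply/eqP.
by rewrite -[RHS]H; apply: eq_bigr => i _; rewrite mxE.
Qed.

Definition in_span3 w1 w2 w3 w := exists k1 k2 k3, w = k1 *: w1 + k2 *: w2 + k3 *: w3.

Lemma vol7_span w1 w2 w3 w a : in_span3 w1 w2 w3 w ->
  forall E, vol7 (wedge1 a w) E w1 w2 w3 = 0 /\ vol7 E (wedge1 a w) w1 w2 w3 = 0.
Proof.
move=> [c1 [c2 [c3 wE]]] E.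
have dep (k : nat) (l : seq 'rV[R]_7) : (k < 4)%N -> size l = 4%N -> nth 0 l k = w ->
    \det (rows7 (l ++ [:: w1; w2; w3])) = 0.
  case: l => [|l0 [|l1 [|l2 [|l3 []]]]] //= k4 _ lw.
  (* The relation has coefficient 1 at the slot [k] occupied by [w], and [- c1], [- c2], [- c3] at
     the slots of [w1], [w2], [w3]. *)
  apply: (@det_rows7_dep _ (rcons (rcons (rcons (set_nth 0 (nseq 4 0) k 1) (- c1)) (- c2)) (- c3))).
    by case: k k4 {lw} => [|[|[|[|]]]] //= _; rewrite ?oner_neq0 ?orbT.
  case: k k4 lw => [|[|[|[|]]]] //= _ ->; rewrite wE !big_ord_recl big_ord0 /=;
  by apply/rowP => j; rewrite !mxE; ring.
have h1 b : forall E, vol7 (rank1 b w) E w1 w2 w3 = 0.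
  by apply: vol7_eq0r => x y; rewrite vol7_rank1 (dep 1%N [:: b; w; x; y]) // mulr0.
have h2 b : forall E, vol7 (rank1 w b) E w1 w2 w3 = 0.
  by apply: vol7_eq0r => x y; rewrite vol7_rank1 (dep 0%N [:: w; b; x; y]) // mulr0.
have h3 b : forall E, vol7 E (rank1 b w) w1 w2 w3 = 0.
  by apply: vol7_eq0l => x y; rewrite vol7_rank1 (dep 3%N [:: x; y; b; w]) // mulr0.
have h4 b : forall E, vol7 E (rank1 w b) w1 w2 w3 = 0.
  by apply: vol7_eq0l => x y; rewrite vol7_rank1 (dep 2%N [:: x; y; w; b]) // mulr0.
by rewrite wedge1_rank1 -scaleN1r vol7Dl vol7Dr vol7Zl vol7Zr h1 h2 h3 h4 mulr0 addr0.
Qed.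

Lemma vol7_repeat w1 w2 w3 a b c d : (a == c) || (a == d) || (b == c) || (b == d) ->
  vol7 (wedge1 a b) (wedge1 c d) w1 w2 w3 = 0.
Proof.
rewrite vol7_wedge1 -!orbA => /or4P[] /eqP->.
- apply: (@det_rows7_dep _ [:: 1; 0; -1]); first by rewrite /= oner_neq0.
  by rewrite !big_ord_recl big_ord0 /=; apply/rowP => j; rewrite !mxE; ring.
- apply: (@det_rows7_dep _ [:: 1; 0; 0; -1]); first by rewrite /= oner_neq0.
  by rewrite !big_ord_recl big_ord0 /=; apply/rowP => j; rewrite !mxE; ring.
- apply: (@det_rows7_dep _ [:: 0; 1; -1]); first by rewrite /= oner_neq0 orbT.
  by rewrite !big_ord_recl big_ord0 /=; apply/rowP => j; rewrite !mxE; ring.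
- apply: (@det_rows7_dep _ [:: 0; 1; 0; -1]); first by rewrite /= oner_neq0 orbT.
  by rewrite !big_ord_recl big_ord0 /=; apply/rowP => j; rewrite !mxE; ring.
Qed.

Lemma evalfDl n (a b v : 'rV[R]_n) : evalf (a + b) v = evalf a v + evalf b v.
Proof. by rewrite /evalf mulmxDl mxE. Qed.
Lemma evalfZl n k (a v : 'rV[R]_n) : evalf (k *: a) v = k * evalf a v.
Proof. by rewrite /evalf -scalemxAl mxE. Qed.
Lemma evalfNl n (a v : 'rV[R]_n) : evalf (- a) v = - evalf a v.
Proof. by rewrite /evalf mulNmx mxE. Qed.
Lemma evalfDr n (a u v : 'rV[R]_n) : evalf a (u + v) = evalf a u + evalf a v.
Proof. by rewrite /evalf linearD mulmxDr mxE. Qed.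
Lemma evalfZr n k (a v : 'rV[R]_n) : evalf a (k *: v) = k * evalf a v.
Proof. by rewrite /evalf linearZ -scalemxAr mxE. Qed.
Lemma evalfE n (a v : 'rV[R]_n) : evalf a v = \sum_j a 0 j * v 0 j.
Proof. by rewrite /evalf mxE; apply: eq_bigr => j _; rewrite mxE. Qed.

(** The interior product of [v] with [a /\ b], in the convention of [contract]. *)
Lemma mulmx_wedge1 n (v a b : 'rV[R]_n) :
  v *m wedge1 a b = evalf a v *: b - evalf b v *: a.
Proof.
have h (x y : 'rV[R]_n) : v *m rank1 x y = evalf x v *: y.
  rewrite /rank1 mulmxA (mx11_scalar (v *m x^T)) mul_scalar_mx; congr (_ *: _).
  by rewrite -[v *m x^T]trmxK trmx_mul trmxK mxE.
by rewrite wedge1_rank1 mulmxBr !h.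
Qed.

Lemma wedge1E n (a b : 'rV[R]_n) i j : wedge1 a b i j = a 0 i * b 0 j - b 0 i * a 0 j.
Proof. by rewrite mxE. Qed.

Lemma wedge1C n (a b : 'rV[R]_n) : wedge1 a b = - wedge1 b a.
Proof. by rewrite !wedge1_rank1 opprB. Qed.

End Volume.

(** * Smooth functions and exterior derivatives *)

Section SmoothOn.
Set Implicit Arguments.
Unset Strict Implicit.
Variables (R : realType) (n : nat) (U : set 'rV[R]_n).
Hypothesis oU : open U.
Implicit Types f g : 'rV[R]_n -> R.

Lemma smooth_diff f x : smooth_on U f -> U x -> differentiable f x.
Proof. by move=> /(_ [::] x). Qed.

Lemma smooth_eq f g : (forall x, U x -> f x = g x) -> smooth_on U f -> smooth_on U g.
Proof. by move=> fg /smooth_onP Hf; apply/smooth_onP => k; exact: Ck_eq (Hf k). Qed.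

Lemma smooth_cst (k : R) : smooth_on U (fun _ => k).
Proof. by apply/smooth_onP => m; exact: Ck_cst. Qed.

Lemma smoothD f g : smooth_on U f -> smooth_on U g -> smooth_on U (fun x => f x + g x).
Proof. by move=> /smooth_onP Hf /smooth_onP Hg; apply/smooth_onP => k; exact: CkD. Qed.

Lemma smoothM f g : smooth_on U f -> smooth_on U g -> smooth_on U (fun x => f x * g x).
Proof. by move=> /smooth_onP Hf /smooth_onP Hg; apply/smooth_onP => k; exact: CkM. Qed.

Lemma smoothN f : smooth_on U f -> smooth_on U (fun x => - f x).
Proof.
by move=> Hf; apply: smooth_eq (smoothM (smooth_cst (-1)) Hf) => x _; rewrite mulN1r.
Qed.

Lemma smoothB f g : smooth_on U f -> smooth_on U g -> smooth_on U (fun x => f x - g x).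
Proof. by move=> Hf Hg; apply: smoothD Hf (smoothN Hg). Qed.

Lemma smoothV f : (forall x, U x -> f x != 0) -> smooth_on U f ->
  smooth_on U (fun x => (f x)^-1).
Proof. by move=> f0 /smooth_onP Hf; apply/smooth_onP => k; exact: CkV. Qed.

Lemma smooth_sqrt f : (forall x, U x -> 0 < f x) -> smooth_on U f ->
  smooth_on U (fun x => Num.sqrt (f x)).
Proof. by move=> f0 /smooth_onP Hf; apply/smooth_onP => k; exact: Ck_sqrt. Qed.

Lemma smooth_partial f j : smooth_on U f -> smooth_on U (partial j f).
Proof. by move=> /smooth_onP Hf; apply/smooth_onP => k; exact: Ck_partial (Hf k.+1). Qed.

Lemma smooth_sum (I : Type) (r : seq I) (P : pred I) (F : I -> 'rV[R]_n -> R) :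
  (forall j, P j -> smooth_on U (F j)) -> smooth_on U (fun x => \sum_(j <- r | P j) F j x).
Proof.
by move=> H; apply/smooth_onP => k; apply: Ck_sum => // j /H /smooth_onP; exact.
Qed.

Lemma smooth_prod (I : Type) (r : seq I) (F : I -> 'rV[R]_n -> R) :
  (forall j, smooth_on U (F j)) -> smooth_on U (fun x => \prod_(j <- r) F j x).
Proof.
by move=> H; apply/smooth_onP => k; apply: Ck_prod => // j; exact: ((smooth_onP _ _).1 (H j) k).
Qed.

Lemma smooth_subset V f : V `<=` U -> smooth_on U f -> smooth_on V f.
Proof. by move=> VU Hf s x /VU; exact: Hf. Qed.

Lemma smooth_det m (A : 'rV[R]_n -> 'M[R]_m) :
  (forall i j, smooth_on U (fun x => A x i j)) -> smooth_on U (fun x => \det (A x)).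
Proof.
move=> HA; apply: smooth_sum => s _; apply: smoothM; first exact: smooth_cst.
by apply: smooth_prod => i; exact: HA.
Qed.

(** By Cramer's rule an entry of the inverse is a cofactor divided by the determinant. This is what
    makes the dual frame of a smooth coframe smooth. *)
Lemma smooth_invmx m (A : 'rV[R]_n -> 'M[R]_m) :
  (forall i j, smooth_on U (fun x => A x i j)) -> (forall x, U x -> A x \in unitmx) ->
  forall i j, smooth_on U (fun x => invmx (A x) i j).
Proof.
move=> HA Au i j.
have det0 x : U x -> \det (A x) != 0 by move=> /Au; rewrite unitmxE unitfE.
have Hc : smooth_on U (fun x => \det (row' j (col' i (A x)))).
  by apply: smooth_det => a b; apply: smooth_eq (HA (lift j a) (lift i b)) => x _; rewrite !mxE.
apply: smooth_eq (smoothM (smoothV det0 (smooth_det HA))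
                   (smoothM (smooth_cst ((-1) ^+ (j + i))) Hc)) => x Ux.
by rewrite /invmx Au // !mxE.
Qed.

Lemma smooth_mapD m (f g : 'rV[R]_n -> 'rV[R]_m) :
  smooth_map_on U f -> smooth_map_on U g -> smooth_map_on U (fun x => f x + g x).
Proof. by move=> Hf Hg j; apply: smooth_eq (smoothD (Hf j) (Hg j)) => x _; rewrite mxE. Qed.

Lemma smooth_mapZ m k (f : 'rV[R]_n -> 'rV[R]_m) :
  smooth_on U k -> smooth_map_on U f -> smooth_map_on U (fun x => k x *: f x).
Proof. by move=> Hk Hf j; apply: smooth_eq (smoothM Hk (Hf j)) => x _; rewrite mxE. Qed.

Lemma smooth_mapB m (f g : 'rV[R]_n -> 'rV[R]_m) :
  smooth_map_on U f -> smooth_map_on U g -> smooth_map_on U (fun x => f x - g x).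
Proof. by move=> Hf Hg j; apply: smooth_eq (smoothB (Hf j) (Hg j)) => x _; rewrite !mxE. Qed.

Definition grad f (x : 'rV[R]_n) : 'rV[R]_n := \row_k partial k f x.

Lemma smooth_grad f : smooth_on U f -> smooth_map_on U (grad f).
Proof. by move=> Hf j; apply: smooth_eq (smooth_partial j Hf) => x _; rewrite mxE. Qed.

Lemma smooth_contract X eta : smooth_map_on U X -> smooth_map_on U eta ->
  smooth_map_on U (Defs.contract X eta).
Proof.
move=> HX He j.
have := @smooth_sum _ (index_enum _) xpredT (fun k x => X x 0 k *
   (partial k (fun y => eta y 0 j) x - partial j (fun y => eta y 0 k) x)).
move=> /(_ (fun k _ => smoothM (HX k) (smoothB (smooth_partial k (He j)) (smooth_partial j (He k))))).
by apply: smooth_eq => x _; rewrite /Defs.contract mxE; apply: eq_bigr => k _; rewrite !mxE.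
Qed.

Lemma d1_eq eta zeta x : (forall y, U y -> eta y = zeta y) -> U x -> d1 eta x = d1 zeta x.
Proof.
move=> H Ux; apply/matrixP => j k; rewrite !mxE.
by congr (_ - _); apply: eq_partial oU _ Ux => y /H ->.
Qed.

Lemma d1D eta zeta x : smooth_map_on U eta -> smooth_map_on U zeta -> U x ->
  d1 (fun y => eta y + zeta y) x = d1 eta x + d1 zeta x.
Proof.
move=> He Hz Ux; apply/matrixP => j k; rewrite !mxE.
have E l m : partial l (fun y => (eta y + zeta y) 0 m) x =
    partial l (fun y => eta y 0 m) x + partial l (fun y => zeta y 0 m) x.
  rewrite -partialD; [|exact: smooth_diff (He m) Ux|exact: smooth_diff (Hz m) Ux].
  by apply: eq_partial oU _ Ux => y _; rewrite mxE.
by rewrite !E opprD addrACA.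
Qed.

Lemma d1Z f eta x : smooth_on U f -> smooth_map_on U eta -> U x ->
  d1 (fun y => f y *: eta y) x = wedge1 (grad f x) (eta x) + f x *: d1 eta x.
Proof.
move=> Hf He Ux; apply/matrixP => j k; rewrite [RHS]mxE wedge1E !mxE.
have E l m : partial l (fun y => (f y *: eta y) 0 m) x =
    f x * partial l (fun y => eta y 0 m) x + eta x 0 m * partial l f x.
  rewrite -partialM; [|exact: smooth_diff Hf Ux|exact: smooth_diff (He m) Ux].
  by apply: eq_partial oU _ Ux => y _; rewrite mxE.
by rewrite !E; ring.
Qed.

(** [d] composed with [d] is zero, by the symmetry of second derivatives. *)
Lemma d1_grad f x : smooth_on U f -> U x -> d1 (grad f) x = 0.
Proof.
move=> /smooth_onP Hf Ux; apply/matrixP => j k; rewrite !mxE.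
have E l m : partial l (fun y => grad f y 0 m) x = partial l (partial m f) x.
  by apply: eq_partial oU _ Ux => y _; rewrite mxE.
by rewrite !E (partialC _ _ oU (Hf 2%N) Ux) subrr.
Qed.

End SmoothOn.

(** * Rank-two systems in an adapted coframe *)

Section Frame.
Set Implicit Arguments.
Unset Strict Implicit.
Variables (R : realType) (Sigma : set 'rV[R]_7) (i : 'rV[R]_7 -> 'rV[R]_8).
Hypothesis oS : open Sigma.
Variables (A B C S T P Q : 'rV[R]_7 -> 'rV[R]_7) (g : 'rV[R]_7 -> R).
Implicit Types (x u v : 'rV[R]_7) (eta : 'rV[R]_7 -> 'rV[R]_7).

Let forms x := [:: A x; B x; C x; S x; T x; P x; Q x].
Definition coframe x := rows7 (forms x).
(** A column of the inverse coframe matrix: the vector on which the form number [k] is 1 and the six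
    others vanish. *)
Definition dual (k : 'I_7) x : 'rV[R]_7 := row k (invmx (coframe x))^T.

Hypotheses (sA : smooth_map_on Sigma A) (sB : smooth_map_on Sigma B)
  (sC : smooth_map_on Sigma C) (sS : smooth_map_on Sigma S)
  (sT : smooth_map_on Sigma T) (sP : smooth_map_on Sigma P)
  (sQ : smooth_map_on Sigma Q).
Hypothesis coframe_unit : forall x, Sigma x -> coframe x \in unitmx.

Let w1 := pullback i (@theta1 R).
Let w2 := pullback i (@theta2 R).
Let w3 := pullback i (@theta3 R).

Hypothesis IFP : forall eta, IF Sigma i eta <-> smooth_map_on Sigma eta /\
  exists g1 g2 g3, [/\ smooth_on Sigma g1, smooth_on Sigma g2, smooth_on Sigma g3 &
    forall x, Sigma x -> eta x = g1 x *: A x + g2 x *: B x + g3 x *: C x].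
(** [spanw] serves to discard terms with a factor [A], [B] or [C] from the bracket, [kerw] to see
    that the remaining term is not zero. *)
Hypothesis spanw : forall x, Sigma x -> [/\ in_span3 (w1 x) (w2 x) (w3 x) (A x),
  in_span3 (w1 x) (w2 x) (w3 x) (B x) & in_span3 (w1 x) (w2 x) (w3 x) (C x)].
Hypothesis kerw : forall x u, Sigma x -> evalf (w1 x) u = 0 -> evalf (w2 x) u = 0 ->
  evalf (w3 x) u = 0 -> [/\ evalf (A x) u = 0, evalf (B x) u = 0 & evalf (C x) u = 0].

Let e := dual (@Ordinal 7 6 isT).

(* These structure equations leave [e], the vector dual to [Q], as the only
   candidate for a Cauchy characteristic of the system spanned by [A] and [B]; the
   obstruction is [g]. *)

Hypothesis structA : forall x, Sigma x -> exists a b,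
  d1 A x = wedge1 a (A x) + wedge1 b (B x) + wedge1 (C x) (S x).
Hypothesis structBC : forall x, Sigma x -> exists a2 b2 tau m a3 b3 c3 D E,
  [/\ d1 B x = wedge1 a2 (A x) + wedge1 b2 (B x) + wedge1 tau (C x)
               - wedge1 (P x + m *: S x) (T x),
      d1 C x = wedge1 a3 (A x) + wedge1 b3 (B x) + wedge1 c3 (C x)
               + wedge1 (Q x) (S x) + wedge1 D (T x) + wedge1 E (P x + m *: S x)
    & evalf tau (e x) = g x].

Definition subsystem : set ('rV[R]_7 -> 'rV[R]_7) :=
  [set eta | smooth_map_on Sigma eta /\
     forall x, Sigma x -> exists k1 k2, eta x = k1 *: A x + k2 *: B x].
Local Notation N := subsystem.

Lemma smooth_coframe (j k : 'I_7) : smooth_on Sigma (fun x => coframe x j k).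
Proof.
case: j => -[|[|[|[|[|[|[|j]]]]]]] // j7;
  [apply: smooth_eq (sA k)|apply: smooth_eq (sB k)|apply: smooth_eq (sC k)
  |apply: smooth_eq (sS k)|apply: smooth_eq (sT k)|apply: smooth_eq (sP k)
  |apply: smooth_eq (sQ k)] => // x _; by rewrite mxE.
Qed.

Lemma smooth_dual k : smooth_map_on Sigma (dual k).
Proof.
move=> j; have := smooth_invmx oS smooth_coframe coframe_unit j k.
by apply: smooth_eq => // x _; rewrite !mxE.
Qed.

Lemma evalf_dual x (j k : 'I_7) : Sigma x ->
  evalf (nth 0 (forms x) j) (dual k x) = (j == k)%:R.
Proof.
move=> Sx; have /matrixP/(_ j k) := mulmxV (coframe_unit Sx).
by rewrite !mxE evalfE => <-; apply: eq_bigr => l _; rewrite !mxE.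
Qed.

Lemma coframe_eq0 x u : Sigma x -> evalf (A x) u = 0 -> evalf (B x) u = 0 ->
  evalf (C x) u = 0 -> evalf (S x) u = 0 -> evalf (T x) u = 0 -> evalf (P x) u = 0 ->
  evalf (Q x) u = 0 -> u = 0.
Proof.
move=> Sx hA hB hC hS hT hP hQ.
have H : coframe x *m u^T = 0.
  apply/matrixP => j k; rewrite ord1 mxE [RHS]mxE.
  transitivity (evalf (nth 0 (forms x) j) u).
    by rewrite evalfE; apply: eq_bigr => l _; rewrite !mxE.
  by case: j => -[|[|[|[|[|[|[|j]]]]]]].
by rewrite -[u]trmxK -(mulKmx (coframe_unit Sx) u^T) H mulmx0 trmx0.
Qed.

Lemma coframe_free x (cs : seq R) : Sigma x ->
  \sum_(j < 7) cs`_j *: nth 0 (forms x) j = 0 -> forall j : 'I_7, cs`_j = 0.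
Proof.
move=> Sx H j; have : evalf (\sum_(l < 7) cs`_l *: nth 0 (forms x) l) (dual j x) = 0.
  by rewrite H /evalf mul0mx mxE.
rewrite (big_morph (fun c => evalf c (dual j x)) (fun a b => evalfDl a b _) (id1 := 0)); last first.
  by rewrite /evalf mul0mx mxE.
rewrite (bigD1 j) //= big1 ?addr0 => [|l lj]; rewrite evalfZl evalf_dual //.
  by rewrite eqxx mulr1.
by rewrite (negPf lj) mulr0.
Qed.

Lemma subsystemA : N A.
Proof. by split=> // x _; exists 1, 0; rewrite scale1r scale0r addr0. Qed.

Lemma subsystemB : N B.
Proof. by split=> // x _; exists 0, 1; rewrite scale1r scale0r add0r. Qed.

Lemma fiber_subsystem x c : Sigma x ->
  fiber N x c <-> exists k1 k2, c = k1 *: A x + k2 *: B x.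
Proof.
move=> Sx; split=> [[eta [_ H] <-]|[k1 [k2 ->]]]; first exact: H.
exists (fun y => k1 *: A y + k2 *: B y) => //; split=> [|y _]; last by exists k1, k2.
by apply: smooth_mapD => //; apply: smooth_mapZ => //; exact: smooth_cst.
Qed.

Lemma subsystem_pfaffian : pfaffian_system Sigma 2 N.
Proof.
split=> [eta|x Sx].
  split=> [He|[se H]].
    by split=> [|x Sx]; [exact: He.1|apply/fiber_subsystem => //; exact: He.2].
  by split=> // x Sx; apply/fiber_subsystem => //; exact: H.
pose M := col_mx (A x) (B x).
have spanM c : (c <= M)%MS <-> exists k1 k2, c = k1 *: A x + k2 *: B x.
  split=> [/submxP[D ->]|[k1 [k2 ->]]].
    rewrite /M -[D](@hsubmxK _ 1 1 1) mul_row_col.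
    exists (lsubmx D 0 0), (rsubmx D 0 0).
    by rewrite -!mul_scalar_mx -!mx11_scalar.
  apply: addmx_sub; apply: scalemx_sub.
    by apply: submx_trans (_ : A x <= M)%MS; rewrite // -addsmxE addsmxSl.
  by apply: submx_trans (_ : B x <= M)%MS; rewrite // -addsmxE addsmxSr.
(* [pfaffian_system] asks for a square matrix; [genmx M] is one with the row space of [M]. *)
exists (genmx M); last first.
  by move=> c; rewrite genmxE; apply: iff_trans (fiber_subsystem _ Sx) (iff_sym (spanM c)).
rewrite genmxE; apply/eqP; apply: inj_row_free => v vM.
have vE : v 0 (lshift 1 0) *: A x + v 0 (rshift 1 0) *: B x = 0.
  rewrite -[RHS]vM -[v in RHS](@hsubmxK _ 1 1 1) mul_row_col.
  by rewrite [lsubmx v]mx11_scalar [rsubmx v]mx11_scalar !mul_scalar_mx !mxE.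
have cs0 := @coframe_free x [:: v 0 (lshift 1 0); v 0 (rshift 1 0)] Sx.
rewrite !big_ord_recl big_ord0 /= !scale0r !addr0 in cs0.
have k1 := cs0 vE (@Ordinal 7 0 isT); have k2 := cs0 vE (@Ordinal 7 1 isT).
apply/rowP => j; rewrite mxE; case: (@splitP 1 1 j) => l jl.
  by rewrite -[RHS]k1; congr (v _ _); apply: val_inj; rewrite /= jl ord1.
by rewrite -[RHS]k2; congr (v _ _); apply: val_inj; rewrite /= jl ord1.
Qed.

(** The pointwise coefficients are pairings with vectors of the smooth dual frame. *)
Lemma subsystem_smooth eta : N eta -> exists f1 f2,
  [/\ smooth_on Sigma f1, smooth_on Sigma f2 &
      forall x, Sigma x -> eta x = f1 x *: A x + f2 x *: B x].
Proof.
move=> [se H].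
have sk k : smooth_on Sigma (fun x => evalf (eta x) (dual k x)).
  have := @smooth_sum _ _ _ oS _ (index_enum _) xpredT (fun j x => eta x 0 j * dual k x 0 j)
    (fun j _ => smoothM oS (se j) (@smooth_dual k j)).
  by apply: smooth_eq => // x _; rewrite evalfE.
exists (fun x => evalf (eta x) (dual (@Ordinal 7 0 isT) x)).
exists (fun x => evalf (eta x) (dual (@Ordinal 7 1 isT) x)).
split=> // x Sx; have [k1 [k2 ->]] := H x Sx.
rewrite !evalfDl !evalfZl.
have D (j k : 'I_7) : evalf (nth 0 (forms x) j) (dual k x) = (j == k)%:R := evalf_dual j k Sx.
rewrite (D (@Ordinal 7 0 isT) (@Ordinal 7 0 isT)) (D (@Ordinal 7 0 isT) (@Ordinal 7 1 isT)).
rewrite (D (@Ordinal 7 1 isT) (@Ordinal 7 0 isT)) (D (@Ordinal 7 1 isT) (@Ordinal 7 1 isT)).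
by rewrite !mulr1 !mulr0 addr0 add0r.
Qed.

Lemma d1_comb eta (f1 f2 f3 : 'rV[R]_7 -> R) x :
  smooth_on Sigma f1 -> smooth_on Sigma f2 -> smooth_on Sigma f3 -> Sigma x ->
  (forall y, Sigma y -> eta y = f1 y *: A y + f2 y *: B y + f3 y *: C y) ->
  d1 eta x = wedge1 (grad f1 x) (A x) + wedge1 (grad f2 x) (B x) +
    wedge1 (grad f3 x) (C x) + (f1 x *: d1 A x + f2 x *: d1 B x + f3 x *: d1 C x).
Proof.
move=> s1 s2 s3 Sx H; rewrite (d1_eq oS H Sx).
have sA1 := smooth_mapZ oS s1 sA; have sB1 := smooth_mapZ oS s2 sB.
have sC1 := smooth_mapZ oS s3 sC.
rewrite (d1D oS (smooth_mapD oS sA1 sB1) sC1 Sx) (d1D oS sA1 sB1 Sx).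
rewrite (d1Z oS s1 sA Sx) (d1Z oS s2 sB Sx) (d1Z oS s3 sC Sx).
by rewrite (addrACA (wedge1 _ (A x)) (f1 x *: d1 A x)) [LHS]addrACA.
Qed.

(** The 2-forms that drop out of the bracket whatever the other factor is, such as those in the
    ideal generated by [w1], [w2], [w3]. *)
Definition negligible x (D : 'M[R]_7) := forall E,
  vol7 D E (w1 x) (w2 x) (w3 x) = 0 /\ vol7 E D (w1 x) (w2 x) (w3 x) = 0.

Lemma negligibleD x D D' : negligible x D -> negligible x D' -> negligible x (D + D').
Proof.
move=> H H' E; have [h1 h2] := H E; have [h3 h4] := H' E.
by rewrite vol7Dl vol7Dr h1 h2 h3 h4 addr0.
Qed.

Lemma negligibleZ x k D : negligible x D -> negligible x (k *: D).
Proof. by move=> H E; have [h1 h2] := H E; rewrite vol7Zl vol7Zr h1 h2 mulr0. Qed.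

Lemma negligible_wedge1 x a c : in_span3 (w1 x) (w2 x) (w3 x) c -> negligible x (wedge1 a c).
Proof. by move=> H E; exact: vol7_span. Qed.

Lemma negligible_wedge1l x a c : in_span3 (w1 x) (w2 x) (w3 x) c -> negligible x (wedge1 c a).
Proof.
move=> H; rewrite (_ : wedge1 c a = (-1) *: wedge1 a c).
  exact/negligibleZ/negligible_wedge1.
by rewrite scaleN1r -wedge1C.
Qed.

(* Modulo the ideal generated by [w1, w2, w3], [d B] is decomposable and [d A]
   vanishes, so the form is isotropic on their span. *)
Lemma bracket_comb x phi psi (f1 f2 f3 g1 g2 g3 : 'rV[R]_7 -> R) : Sigma x ->
  smooth_on Sigma f1 -> smooth_on Sigma f2 -> smooth_on Sigma f3 ->
  smooth_on Sigma g1 -> smooth_on Sigma g2 -> smooth_on Sigma g3 ->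
  (forall y, Sigma y -> phi y = f1 y *: A y + f2 y *: B y + f3 y *: C y) ->
  (forall y, Sigma y -> psi y = g1 y *: A y + g2 y *: B y + g3 y *: C y) ->
  f3 x = 0 -> exists2 k, k != 0 & bracket7 i phi psi x = k * f2 x * g3 x.
Proof.
move=> Sx sf1 sf2 sf3 sg1 sg2 sg3 Hphi Hpsi f30.
have [hA hB hC] := spanw Sx.
have [a2 [b2 [tau [m [a3 [b3 [c3 [D [E [EB EC _]]]]]]]]]] := structBC Sx.
pose PT := wedge1 (P x + m *: S x) (T x).
pose W := wedge1 (Q x) (S x) + wedge1 D (T x) + wedge1 E (P x + m *: S x).
have dec (eta : 'rV[R]_7 -> 'rV[R]_7) h1 h2 h3 : smooth_on Sigma h1 -> smooth_on Sigma h2 ->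
    smooth_on Sigma h3 ->
    (forall y, Sigma y -> eta y = h1 y *: A y + h2 y *: B y + h3 y *: C y) ->
    exists2 Z, negligible x Z & d1 eta x = Z + (- h2 x *: PT + h3 x *: W).
  move=> s1 s2 s3 H.
  exists (d1 eta x - (- h2 x *: PT + h3 x *: W)); last by rewrite subrK.
  rewrite (d1_comb s1 s2 s3 Sx H) EB EC.
  set nA := wedge1 a2 _ + _ + _; set nC := wedge1 a3 _ + _ + _.
  have nn (a b c : 'rV[R]_7) : negligible x (wedge1 a (A x) + wedge1 b (B x) + wedge1 c (C x)).
    by apply: negligibleD (negligibleD _ _) _; exact: negligible_wedge1.
  have [a1 [b1 EA]] := structA Sx.
  have nA1 : negligible x (d1 A x).
    rewrite EA; apply: negligibleD (negligible_wedge1l _ hC).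
    by apply: negligibleD; exact: negligible_wedge1.
  rewrite (_ : _ - _ = wedge1 (grad h1 x) (A x) + wedge1 (grad h2 x) (B x) +
    wedge1 (grad h3 x) (C x) + (h1 x *: d1 A x + h2 x *: nA + h3 x *: nC)).
    apply: negligibleD (nn _ _ _) (negligibleD (negligibleD _ _) _);
      apply: negligibleZ; (exact: nA1 || exact: nn).
  rewrite /W /PT -addrA; congr (_ + _).
  by apply/matrixP => r s; rewrite !(mxE,wedge1E); ring.
have [Z1 nZ1 E1] := dec _ _ _ _ sf1 sf2 sf3 Hphi.
have [Z2 nZ2 E2] := dec _ _ _ _ sg1 sg2 sg3 Hpsi.
(* Modulo negligible terms [dB] is [- PT] with [PT = P' /\ T], where [P' = P + m S]. Every term of
   [dC] but [Q /\ S] shares a factor with [PT], so the constant is minus the volume of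
   [P', T, Q, S, w1, w2, w3], again a coframe. *)
exists (- \det (rows7 [:: P x + m *: S x; T x; Q x; S x; w1 x; w2 x; w3 x])).
  rewrite oppr_eq0; apply: det_rows7_neq0 => u Hu.
  have [[h1 h2] h3] := (Hu (@Ordinal 7 4 isT), Hu (@Ordinal 7 5 isT), Hu (@Ordinal 7 6 isT)).
  have [[h4 h5] h6] := (Hu (@Ordinal 7 1 isT), Hu (@Ordinal 7 2 isT), Hu (@Ordinal 7 3 isT)).
  have := Hu (@Ordinal 7 0 isT); rewrite /= evalfDl evalfZl h6 mulr0 addr0 => h7.
  by have [kA kB kC] := kerw Sx h1 h2 h3; apply: (coframe_eq0 Sx kA kB kC h6 h4 h7 h5).
have -> : bracket7 i phi psi x = vol7 (d1 phi x) (d1 psi x) (w1 x) (w2 x) (w3 x) by [].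
rewrite E1 E2 f30 scale0r addr0.
rewrite vol7Dl (nZ1 _).1 add0r vol7Dr (nZ2 _).2 add0r vol7Zl vol7Dr !vol7Zr.
have rT a : vol7 PT (wedge1 a (T x)) (w1 x) (w2 x) (w3 x) = 0.
  by apply: vol7_repeat; rewrite eqxx !orbT.
have rP a : vol7 PT (wedge1 a (P x + m *: S x)) (w1 x) (w2 x) (w3 x) = 0.
  by apply: vol7_repeat; rewrite eqxx !orbT.
rewrite /W !vol7Dr rP !rT vol7_wedge1 mulr0 add0r !addr0 !mulNr; congr (- _).
by rewrite mulrA mulrC mulrA.
Qed.

Lemma subsystem_comb3 eta : N eta -> exists f1 f2,
  [/\ smooth_on Sigma f1, smooth_on Sigma f2 & forall x, Sigma x ->
      eta x = f1 x *: A x + f2 x *: B x + (fun _ => 0) x *: C x].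
Proof.
move=> /subsystem_smooth[f1 [f2 [s1 s2 H]]]; exists f1, f2; split=> // x Sx.
by rewrite scale0r addr0 H.
Qed.

Lemma subsystem_isotropic : isotropic Sigma i N.
Proof.
split=> [eta Neta|phi psi Nphi Npsi x Sx].
  have [f1 [f2 [s1 s2 H]]] := subsystem_comb3 Neta; apply/IFP; split; first exact: Neta.1.
  by exists f1, f2, (fun _ => 0); split => //; exact: smooth_cst.
have [f1 [f2 [s1 s2 Hf]]] := subsystem_comb3 Nphi.
have [g1 [g2 [t1 t2 Hg]]] := subsystem_comb3 Npsi.
have s0 : smooth_on Sigma (fun=> 0) := smooth_cst 0.
by have [k _ ->] := bracket_comb Sx s1 s2 s0 t1 t2 s0 Hf Hg erefl; rewrite mulr0.
Qed.

(** Pairing with [B] alone suffices: the bracket of [B] with [f1 A + f2 B + f3 C] is a nonzero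
    multiple of [f3], so an isotropic system containing [B] has no [C] component. *)
Lemma subsystem_max_isotropic : max_isotropic2 Sigma i N.
Proof.
split; [exact: subsystem_pfaffian|exact: subsystem_isotropic|].
move=> k N' _ [N'IF N'iso] NN'; apply/seteqP; split=> // eta N'eta.
have [seta [f1 [f2 [f3 [s1 s2 s3 H]]]]] := (IFP eta).1 (N'IF _ N'eta).
split=> // x Sx; exists (f1 x), (f2 x); rewrite H //.
suff -> : f3 x = 0 by rewrite scale0r addr0.
have [z1 z0] := (smooth_cst (U := Sigma) 1, smooth_cst (U:=Sigma) 0).
have HB y : Sigma y -> B y = 0 *: A y + 1 *: B y + 0 *: C y.
  by rewrite !scale0r scale1r addr0 add0r.
have [k' k'0] := bracket_comb Sx z0 z1 z0 s1 s2 s3 HB H erefl.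
rewrite N'iso //; last exact: NN' subsystemB.
by move=> /esym/eqP; rewrite mulr1 mulf_eq0 (negPf k'0) => /eqP.
Qed.

Lemma evalf_last_dual x : Sigma x ->
  [/\ evalf (A x) (e x) = 0, evalf (B x) (e x) = 0 & evalf (C x) (e x) = 0] /\
  [/\ evalf (S x) (e x) = 0, evalf (T x) (e x) = 0, evalf (P x) (e x) = 0 &
     evalf (Q x) (e x) = 1].
Proof.
move=> Sx; have D (j : 'I_7) := evalf_dual j (@Ordinal 7 6 isT) Sx.
split; split; [exact: D (@Ordinal 7 0 isT)|exact: D (@Ordinal 7 1 isT)
  |exact: D (@Ordinal 7 2 isT)|exact: D (@Ordinal 7 3 isT)|exact: D (@Ordinal 7 4 isT)
  |exact: D (@Ordinal 7 5 isT)|exact: D (@Ordinal 7 6 isT)].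
Qed.

(** Contracting [e] with [dA] and [dB] leaves the span of [A] and [B] only through [tau(e) C], so
    the obstruction is [c * g x] times the coefficient [f2] of [B]. *)
Lemma cauchy_char_at_last_dual x (c : R) eta : Sigma x -> c * g x = 0 -> N eta ->
  evalf (eta x) (c *: e x) = 0 /\ fiber N x (c *: e x *m d1 eta x).
Proof.
move=> Sx cg /subsystem_comb3[f1 [f2 [s1 s2 H]]].
have [[eA eB eC] [eS eT eP _]] := evalf_last_dual Sx.
split; first by rewrite H // scale0r addr0 evalfZr evalfDl !evalfZl eA eB !mulr0 addr0 mulr0.
have z0 := smooth_cst (U := Sigma) 0.
apply/fiber_subsystem => //; rewrite (d1_comb s1 s2 z0 Sx H).
have [a [b EA]] := structA Sx.
have [a2 [b2 [tau [m [_ [_ [_ [_ [_ [EB _ Et]]]]]]]]]] := structBC Sx.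
rewrite -scalemxAl EA EB !scale0r addr0 !(mulmxDr, mulmxN, =^~ scalemxAr) !mulmx_wedge1.
rewrite evalfDl evalfZl eA eB eC eS eT eP Et.
exists (c * (evalf (grad f1 x) (e x) + f1 x * evalf a (e x) + f2 x * evalf a2 (e x))).
exists (c * (evalf (grad f2 x) (e x) + f1 x * evalf b (e x) + f2 x * evalf b2 (e x))).
have -> : grad (fun _ : 'rV[R]_7 => 0 : R) x = 0.
  by apply/rowP => j; rewrite !mxE; exact: partial_cst.
have -> : evalf 0 (e x) = 0 by rewrite /evalf mul0mx mxE.
apply/rowP => j; rewrite !mxE; have key : c * g x * (f2 x * C x 0 j) = 0 by rewrite cg mul0r.
by apply/eqP; rewrite -subr_eq0; apply/eqP; rewrite -[RHS]key; ring.
Qed.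

Lemma cauchy_char_atP x v : Sigma x ->
  cauchy_char_at N x v <-> exists2 c, v = c *: e x & c * g x = 0.
Proof.
move=> Sx; split=> [H|[c -> cg] eta Neta]; last exact: cauchy_char_at_last_dual.
have [vA /fiber_subsystem-/(_ Sx)[k1 [k2 E1]]] := H _ subsystemA.
have [vB /fiber_subsystem-/(_ Sx)[l1 [l2 E2]]] := H _ subsystemB.
have [a [b EA]] := structA Sx.
have [a2 [b2 [tau [m [_ [_ [_ [_ [_ [EB _ Et]]]]]]]]]] := structBC Sx.
rewrite EA !mulmxDr !mulmx_wedge1 vA vB in E1.
(* Coefficients, along [A, B, C, S], of the vanishing difference between the contraction of [v] with
   [dA] and its value in the span of [A] and [B]. [cs2] does the same for [dB], along
   [A, B, C, S, T, P]. *)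
pose cs1 := [:: evalf a v - k1; evalf b v - k2; - evalf (S x) v; evalf (C x) v].
have Z1 := @coframe_free x cs1 Sx.
have {}Z1 := Z1 _; rewrite !big_ord_recl big_ord0 /= in Z1.
have {}Z1 : forall j : 'I_7, cs1`_j = 0.
  apply: Z1; rewrite !scale0r !addr0; apply/rowP => j; move/rowP/(_ j): E1.
  rewrite !mxE => /eqP; rewrite -subr_eq0 => /eqP E1; rewrite -[RHS]E1; ring.
have vC : evalf (C x) v = 0 := Z1 (@Ordinal 7 3 isT).
have vS : evalf (S x) v = 0 by apply/eqP; rewrite -oppr_eq0; apply/eqP; exact: Z1 (@Ordinal 7 2 isT).
rewrite EB !(mulmxDr, mulmxN) !mulmx_wedge1 vA vB vC evalfDl evalfZl vS mulr0 addr0 in E2.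
pose cs2 := [:: evalf a2 v - l1; evalf b2 v - l2; evalf tau v; evalf (T x) v * m;
  - evalf (P x) v; evalf (T x) v].
have Z2 := @coframe_free x cs2 Sx.
rewrite !big_ord_recl big_ord0 /= in Z2.
have {}Z2 : forall j : 'I_7, cs2`_j = 0.
  apply: Z2; rewrite !scale0r !addr0; apply/rowP => j; move/rowP/(_ j): E2.
  rewrite !mxE => /eqP; rewrite -subr_eq0 => /eqP E2; rewrite -[RHS]E2; ring.
have vT : evalf (T x) v = 0 := Z2 (@Ordinal 7 5 isT).
have vP : evalf (P x) v = 0 by apply/eqP; rewrite -oppr_eq0; apply/eqP; exact: Z2 (@Ordinal 7 4 isT).
have vtau : evalf tau v = 0 := Z2 (@Ordinal 7 2 isT).
have [[eA eB eC] [eS eT eP eQ]] := evalf_last_dual Sx.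
have vE : v = evalf (Q x) v *: e x.
  apply/eqP; rewrite -subr_eq0; apply/eqP; rewrite -scaleNr.
  apply: (coframe_eq0 Sx); rewrite evalfDr evalfZr ?vA ?vB ?vC ?vS ?vT ?vP
     ?eA ?eB ?eC ?eS ?eT ?eP ?eQ ?mulr0 ?addr0 //.
  by rewrite mulr1 subrr.
by exists (evalf (Q x) v) => //; rewrite -Et -evalfZr -vE.
Qed.

Lemma smooth_last_dual : smooth_map_on Sigma e.
Proof. exact: smooth_dual. Qed.

Lemma cauchy_char_pointwise X x : cauchy_char Sigma N X -> Sigma x -> cauchy_char_at N x (X x).
Proof.
move=> [_ H] Sx eta Neta; have [h1 h2] := H eta Neta; split; first exact: h1.
by exists (Defs.contract X eta).
Qed.

Lemma last_dual_neq0 x : Sigma x -> e x != 0.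
Proof.
move=> Sx; have [_ [_ _ _ eQ]] := evalf_last_dual Sx; apply/eqP => e0.
by move: eQ; rewrite e0 /evalf trmx0 mulmx0 mxE => /esym/eqP; rewrite oner_eq0.
Qed.

Lemma evalf_full_eq0 v : (forall c, evalf c v = 0) -> v = 0.
Proof.
move=> H; apply/rowP => j; have := H (delta_mx 0 j).
by rewrite /evalf -rowE !mxE.
Qed.

(** Where [g] is not zero all characteristics vanish, so every covector lies in the Cartan system
    and its rank is 7. If [g] vanishes identically, the multiples of [e] are global characteristics
    and the Cartan system is the annihilator of [e]. *)
Lemma subsystem_class6 : class_is Sigma N 6 <-> forall x, Sigma x -> g x = 0.
Proof.
split=> [[H1 H2] x Sx|g0].
  apply/eqP/negPn/negP => gx; have [M rM HM] := H2 x Sx.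
  have full (c : 'rV[R]_7) : (c <= M)%MS.
    apply: (HM c).1 => X HX.
    have /(cauchy_char_atP _ Sx)[k -> /eqP] := cauchy_char_pointwise HX Sx.
    rewrite mulf_eq0 (negPf gx) orbF => /eqP->.
    by rewrite scale0r /evalf trmx0 mulmx0 mxE.
  have : (1%:M <= M)%MS by apply/row_subP => j; exact: full.
  by rewrite sub1mx /row_full rM.
have He c : cauchy_char Sigma N (fun y => c *: e y).
  split; first by apply: smooth_mapZ => //; [exact: smooth_cst|exact: smooth_last_dual].
  move=> eta Neta.
  have K y (Sy : Sigma y) := @cauchy_char_at_last_dual y c eta Sy (etrans (congr1 _ (g0 y Sy)) (mulr0 c)) Neta.
  split=> [y /K[]//|]; split=> [|y Sy].
    apply: smooth_contract => //; last exact: Neta.1.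
    by apply: smooth_mapZ => //; [exact: smooth_cst|exact: smooth_last_dual].
  by apply/fiber_subsystem => //; have [] := K y Sy.
split=> [x v Sx /(cauchy_char_atP _ Sx)[c -> _]|x Sx]; first by exists (fun y => c *: e y).
exists (kermx (e x)^T).
  rewrite mxrank_ker mxrank_tr; have := rank_leq_row (e x).
  by case E : (\rank (e x)) => [|[|]] //; move/eqP: E; rewrite mxrank_eq0 (negPf (last_dual_neq0 Sx)).
move=> c; split=> [H|/sub_kermxP H X].
  apply/sub_kermxP; rewrite [_ *m _]mx11_scalar -/(evalf _ _).
  by have := H _ (He 1); rewrite scale1r => ->; rewrite raddf0.
move=> HX; have /(cauchy_char_atP _ Sx)[k -> _] := cauchy_char_pointwise HX Sx.
by rewrite evalfZr /evalf H mxE mulr0.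
Qed.

Lemma subsystem_class7 : class_is Sigma N 7 <-> forall x, Sigma x -> g x <> 0.
Proof.
split=> [[H1 H2] x Sx gx|g0].
  have [M rM HM] := H2 x Sx.
  (* A zero of [g] makes [e x] characteristic at this one point. The first clause of [class_is]
     extends it to a global characteristic, which not every covector annihilates. *)
  have /H1-/(_ Sx)[X HX Xe] : cauchy_char_at N x (1 *: e x).
    by apply/cauchy_char_atP => //; exists 1; rewrite // mul1r.
  have /eqP := last_dual_neq0 Sx; apply; rewrite -[e x]scale1r -Xe; apply: evalf_full_eq0 => c.
  by apply: (HM c).2 _ HX; apply: submx_full; rewrite /row_full rM.
have at0 x v : Sigma x -> cauchy_char_at N x v -> v = 0.
  move=> Sx /(cauchy_char_atP _ Sx)[c -> /eqP].
  by rewrite mulf_eq0 => /orP[/eqP->|/eqP/(g0 x Sx)//]; rewrite scale0r.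
split=> [x v Sx /(at0 _ _ Sx) ->|x Sx].
  exists (fun=> 0) => //; split=> [j|eta Neta].
    by apply: smooth_eq (smooth_cst 0) => // y _; rewrite mxE.
  have E0 y : Defs.contract (fun=> 0) eta y = 0 by rewrite /Defs.contract mul0mx.
  split=> [y _|]; first by rewrite /evalf trmx0 mulmx0 mxE.
  split=> [|y Sy].
    apply: smooth_contract => //; last exact: Neta.1.
    by move=> j; apply: smooth_eq (smooth_cst 0) => // y _; rewrite mxE.
  by exists 0, 0; rewrite E0 !scale0r addr0.
exists 1%:M; first by rewrite mxrank1.
move=> c; split=> [_|_ X]; first exact: submx1.
move=> HX; rewrite (at0 _ _ Sx (cauchy_char_pointwise HX Sx)).
by rewrite /evalf trmx0 mulmx0 mxE.
Qed.

End Frame.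

(** * Structure equations *)

Section StructureEquations.
Set Implicit Arguments.
Unset Strict Implicit.
Variables (R : realType) (n : nat) (dx dy dz dp dq dr ds dt da : 'rV[R]_n).
Variables (p q r s t a b m K2 k3 k4 k5 : R).

Let w1 := dz - p *: dx - q *: dy.
Let w2 := dp - r *: dx - s *: dy.
Let w3 := dq - s *: dx - t *: dy.
Let B := w2 + a *: w3.
Let S := a *: dx - dy.
Let T := dx - b *: dy.
Let P := dr + a *: ds.

Lemma structure_equation1 :
  - wedge1 dp dx - wedge1 dq dy = wedge1 0 w1 + wedge1 dx B + wedge1 w3 S.
Proof. by apply/matrixP => j k; rewrite /B /w1 /w2 /w3 /S !(mxE, wedge1E); ring. Qed.

Hypothesis rel : b *: dr + (1 + a * b) *: ds + a *: dt +
  (- m * (1 - a * b) *: dx + K2 *: dy + k3 *: w1 + k4 *: w2 + k5 *: w3) = 0.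

(** With [c] the component of [P], the relation becomes [b c + ds + a dt + ... = 0]; here [ds] has
    coefficient 1, and it can be eliminated without division. *)
Let relE j : exists c, dr 0 j = c - a * ds 0 j /\
  ds 0 j = - (b * c + a * dt 0 j + (- m * (1 - a * b) * dx 0 j +
      K2 * dy 0 j + k3 * w1 0 j + k4 * w2 0 j + k5 * w3 0 j)).
Proof.
exists (dr 0 j + a * ds 0 j); split; first by rewrite addrK.
move/rowP/(_ j): rel; rewrite /w1 /w2 /w3 !mxE => E.
apply/eqP; rewrite -subr_eq0 -[X in _ == X]E; apply/eqP; ring.
Qed.

(** The left side is [- P /\ dx - (ds + a dt) /\ dy + da /\ w3]. By the relation, [ds + a dt] is
    [- b P + m (1 - a b) dx - K2 dy] modulo the contact forms, and [(1 - a b) dx /\ dy = S /\ T]. *)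
Lemma structure_equation2 :
  - wedge1 dr dx - wedge1 ds dy + (wedge1 da w3 + a *: (- wedge1 ds dx - wedge1 dt dy)) =
  wedge1 (- k3 *: dy) w1 + wedge1 (- k4 *: dy) B +
  wedge1 (da - (k5 - a * k4) *: dy) w3 - wedge1 (P + m *: S) T.
Proof.
apply/matrixP => j k; have [cj [rj sj]] := relE j; have [ck [rk sk]] := relE k.
move: rj sj rk sk; rewrite /B /P /S /T /w1 /w2 /w3 !mxE => rj sj rk sk.
by rewrite rj rk sj sk; ring.
Qed.

(** Only the term [dt /\ S] matters later: the others contain [w1], [B], [w3], [T] or [P + m S], all
    of which disappear in the bracket with [B]. *)
Lemma structure_equation3 :
  - wedge1 ds dx - wedge1 dt dy =
  wedge1 (- k3 *: dx) w1 + wedge1 (- k4 *: dx) B + wedge1 (- (k5 - a * k4) *: dx) w3 +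
  wedge1 dt S + wedge1 ((K2 + b * m) *: dy) T + wedge1 (- b *: dx) (P + m *: S).
Proof.
apply/matrixP => j k; have [cj [rj sj]] := relE j; have [ck [rk sk]] := relE k.
move: rj sj rk sk; rewrite /B /P /S /T /w1 /w2 /w3 !mxE => rj sj rk sk.
by rewrite rj rk sj sk; ring.
Qed.

End StructureEquations.

(** * One characteristic system, for eight functions playing the role of jet coordinates *)

Section Characteristic.
Set Implicit Arguments.
Unset Strict Implicit.
Variables (R : realType) (Sigma : set 'rV[R]_7) (i : 'rV[R]_7 -> 'rV[R]_8).
Hypothesis oS : open Sigma.
Variables (fx fy fz fp fq fr fs ft a b : 'rV[R]_7 -> R).
Hypotheses (sx : smooth_on Sigma fx) (sy : smooth_on Sigma fy)
  (sz : smooth_on Sigma fz) (sp : smooth_on Sigma fp) (sq : smooth_on Sigma fq)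
  (sr : smooth_on Sigma fr) (ss : smooth_on Sigma fs) (st : smooth_on Sigma ft)
  (sa : smooth_on Sigma a) (sb : smooth_on Sigma b).

Definition contact (f h1 k1 h2 k2 : 'rV[R]_7 -> R) x :=
  grad f x - h1 x *: grad k1 x - h2 x *: grad k2 x.
Let w1 := contact fz fp fx fq fy.
Let w2 := contact fp fr fx fs fy.
Let w3 := contact fq fs fx ft fy.

Let B x := w2 x + a x *: w3 x.
Let S x := a x *: grad fx x - grad fy x.
Let T x := grad fx x - b x *: grad fy x.
Let P x := grad fr x + a x *: grad fs x.
Let Q := grad ft.

Hypothesis ab1 : forall x, Sigma x -> 1 - a x * b x != 0.
Hypothesis rel : forall x, Sigma x -> exists K1 K2 k3 k4 k5,
  b x *: grad fr x + (1 + a x * b x) *: grad fs x + a x *: grad ft x +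
  (K1 *: grad fx x + K2 *: grad fy x + k3 *: w1 x + k4 *: w2 x + k5 *: w3 x) = 0.
Hypothesis span_grad : forall x u, Sigma x ->
  (forall f, f \in [:: fx; fy; fz; fp; fq; fr; fs; ft] -> evalf (grad f x) u = 0) ->
  u = 0.
Hypothesis pb1 : forall x, Sigma x -> pullback i (@theta1 R) x = w1 x.
(** The exchange of [x] and [y] also exchanges [theta2] and [theta3]; the second alternative covers
    that case. *)
Hypothesis pb23 :
  (forall x, Sigma x -> pullback i (@theta2 R) x = w2 x /\ pullback i (@theta3 R) x = w3 x) \/
  (forall x, Sigma x -> pullback i (@theta2 R) x = w3 x /\ pullback i (@theta3 R) x = w2 x).

Lemma smooth_contact f h1 k1 h2 k2 : smooth_on Sigma f -> smooth_on Sigma h1 ->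
  smooth_on Sigma k1 -> smooth_on Sigma h2 -> smooth_on Sigma k2 ->
  smooth_map_on Sigma (contact f h1 k1 h2 k2).
Proof.
move=> sf sh1 sk1 sh2 sk2; apply: smooth_mapB => //; last first.
  by apply: smooth_mapZ => //; exact: smooth_grad.
apply: smooth_mapB => //; first exact: smooth_grad.
by apply: smooth_mapZ => //; exact: smooth_grad.
Qed.

Lemma d1_contact f h1 k1 h2 k2 x : smooth_on Sigma f -> smooth_on Sigma h1 ->
  smooth_on Sigma k1 -> smooth_on Sigma h2 -> smooth_on Sigma k2 -> Sigma x ->
  d1 (contact f h1 k1 h2 k2) x =
  - wedge1 (grad h1 x) (grad k1 x) - wedge1 (grad h2 x) (grad k2 x).
Proof.
move=> sf sh1 sk1 sh2 sk2 Sx.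
have m1 : smooth_on Sigma (fun y => -1 * h1 y) by apply: smoothM => //; exact: smooth_cst.
have m2 : smooth_on Sigma (fun y => -1 * h2 y) by apply: smoothM => //; exact: smooth_cst.
have E y : Sigma y -> contact f h1 k1 h2 k2 y =
    grad f y + (-1 * h1 y) *: grad k1 y + (-1 * h2 y) *: grad k2 y.
  by rewrite !mulN1r !scaleNr.
have [gf g1 g2] := And3 (smooth_grad oS sf) (smooth_grad oS sk1) (smooth_grad oS sk2).
have z1 := smooth_mapZ oS m1 g1; have z2 := smooth_mapZ oS m2 g2.
rewrite (d1_eq oS E Sx) (d1D oS (smooth_mapD oS gf z1) z2 Sx) (d1D oS gf z1 Sx).
rewrite (d1Z oS m1 g1 Sx) (d1Z oS m2 g2 Sx) !(d1_grad oS) // !scaler0 add0r !addr0.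
have gN h : smooth_on Sigma h -> grad (fun y => -1 * h y) x = - grad h x.
  move=> sh; apply/rowP => j; rewrite !mxE partialM;
    [|exact: smooth_diff (smooth_cst _) Sx|exact: smooth_diff sh Sx].
  by rewrite partial_cst mulr0 addr0 mulN1r.
have wN (c d : 'rV[R]_7) : wedge1 (- c) d = - wedge1 c d.
  by apply/matrixP => j k; rewrite !mxE; ring.
by rewrite !gN // !wN.
Qed.

Let sw1 : smooth_map_on Sigma w1. Proof. exact: smooth_contact. Qed.
Let sw2 : smooth_map_on Sigma w2. Proof. exact: smooth_contact. Qed.
Let sw3 : smooth_map_on Sigma w3. Proof. exact: smooth_contact. Qed.
Let sB : smooth_map_on Sigma B.
Proof. by apply: smooth_mapD => //; exact: smooth_mapZ. Qed.
Let sS : smooth_map_on Sigma S.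
Proof. by apply: smooth_mapB; [|apply: smooth_mapZ => //|]; try exact: smooth_grad. Qed.
Let sT : smooth_map_on Sigma T.
Proof. by apply: smooth_mapB; [| |apply: smooth_mapZ => //]; try exact: smooth_grad. Qed.
Let sP : smooth_map_on Sigma P.
Proof. by apply: smooth_mapD; [| |apply: smooth_mapZ => //]; try exact: smooth_grad. Qed.
Let sQ : smooth_map_on Sigma Q. Proof. exact: smooth_grad. Qed.

Lemma evalf_contact f h1 k1 h2 k2 x u : evalf (contact f h1 k1 h2 k2 x) u =
  evalf (grad f x) u - h1 x * evalf (grad k1 x) u - h2 x * evalf (grad k2 x) u.
Proof. by rewrite /contact !evalfDl !evalfNl !evalfZl. Qed.

(* A vector annihilated by the first six forms of the coframe is vertical and
   proportional to [(a^2, -a, 1)] in the fibre coordinates [(r, s, t)]. *)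
Lemma characteristic_vector x u : Sigma x -> evalf (w1 x) u = 0 -> evalf (B x) u = 0 ->
  evalf (w3 x) u = 0 -> evalf (S x) u = 0 -> evalf (T x) u = 0 -> evalf (P x) u = 0 ->
  [/\ evalf (grad fx x) u = 0, evalf (grad fy x) u = 0, evalf (grad fz x) u = 0,
      evalf (grad fp x) u = 0 & evalf (grad fq x) u = 0] /\
  evalf (grad fr x) u = a x ^+ 2 * evalf (Q x) u /\ evalf (grad fs x) u = - a x * evalf (Q x) u.
Proof.
move=> Sx u1 u2 u3 uS uT uP.
have [K1 [K2 [k3 [k4 [k5 E]]]]] := rel Sx.
have w20 : evalf (w2 x) u = 0 by move: u2; rewrite /B evalfDl evalfZl u3 mulr0 addr0.
have := congr1 (fun c => evalf c u) E.
rewrite !evalfDl !evalfZl u1 w20 u3 !mulr0 !addr0 => {}E.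
move: u1 w20 u3; rewrite /w1 /w2 /w3 !evalf_contact => u1 w20 u3.
move: uS uT uP; rewrite /S /T /P !evalfDl !evalfNl !evalfZl => uS uT uP.
have e0 : evalf 0 u = 0 by rewrite /evalf mul0mx mxE.
rewrite e0 in E; move: E uS uT uP u1 w20 u3 (ab1 Sx); rewrite /Q.
move: (evalf (grad fx x) u) (evalf (grad fy x) u) (evalf (grad fz x) u) => X Y Z.
move: (evalf (grad fp x) u) (evalf (grad fq x) u) => p q.
move: (evalf (grad fr x) u) (evalf (grad fs x) u) (evalf (grad ft x) u) => r s t.
move=> E uS uT uP u1 w20 u3 ab.
(* [T - b S = (1 - a b) dx], so [S] and [T] together determine [dx] and [dy]. *)
have X0 : X = 0.
  apply: (mulfI ab); rewrite mulr0.
  have -> : (1 - a x * b x) * X = X - b x * Y - b x * (a x * X - Y) by ring.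
  by rewrite uS uT mulr0 subr0.
have Y0 : Y = 0 by move: uS; rewrite X0 mulr0 sub0r => /eqP; rewrite oppr_eq0 => /eqP.
rewrite X0 Y0 !mulr0 !subr0 in u1 w20 u3; rewrite X0 Y0 !mulr0 !addr0 in E.
have s0 : s + a x * t = 0.
  have -> : s + a x * t = b x * r + (1 + a x * b x) * s + a x * t - b x * (r + a x * s) by ring.
  by rewrite E uP mulr0 subr0.
have sE : s = - a x * t by apply/eqP; rewrite mulNr -addr_eq0 s0.
split; first by split.
split; last exact: sE.
by apply/eqP; rewrite -subr_eq0 -[X in _ == X]uP sE; apply/eqP; ring.
Qed.

Lemma characteristic_coframe x : Sigma x -> coframe w1 B w3 S T P Q x \in unitmx.
Proof.
move=> Sx; rewrite unitmxE unitfE; apply: det_rows7_neq0 => u Hu.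
have [[h0 h1] h2] := (Hu (@Ordinal 7 0 isT), Hu (@Ordinal 7 1 isT), Hu (@Ordinal 7 2 isT)).
have [[h3 h4] h5] := (Hu (@Ordinal 7 3 isT), Hu (@Ordinal 7 4 isT), Hu (@Ordinal 7 5 isT)).
have h6 : evalf (Q x) u = 0 := Hu (@Ordinal 7 6 isT).
have [[ux uy uz up uq] [ur us]] := characteristic_vector Sx h0 h1 h2 h3 h4 h5.
rewrite h6 !mulr0 in ur us; apply: (span_grad Sx) => f.
by rewrite !inE => /or4P[/eqP->|/eqP->|/eqP->|/or4P[/eqP->|/eqP->|/eqP->|/orP[]/eqP->]].
Qed.

Let structA x : Sigma x -> exists c d,
  d1 w1 x = wedge1 c (w1 x) + wedge1 d (B x) + wedge1 (w3 x) (S x).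
Proof.
move=> Sx; exists 0, (grad fx x); rewrite d1_contact //.
exact: structure_equation1.
Qed.

(** [tau] is [da] up to a multiple of [dy], which [e] annihilates; this identifies the obstruction
    as [da(e)]. *)
Let structBC (e : 'rV[R]_7 -> 'rV[R]_7) x : Sigma x -> evalf (grad fy x) (e x) = 0 ->
  exists a2 b2 tau m a3 b3 c3 D E,
  [/\ d1 B x = wedge1 a2 (w1 x) + wedge1 b2 (B x) + wedge1 tau (w3 x)
               - wedge1 (P x + m *: S x) (T x),
      d1 w3 x = wedge1 a3 (w1 x) + wedge1 b3 (B x) + wedge1 c3 (w3 x)
               + wedge1 (Q x) (S x) + wedge1 D (T x) + wedge1 E (P x + m *: S x)
    & evalf tau (e x) = evalf (grad a x) (e x)].
Proof.
move=> Sx ey; have [K1 [K2 [k3 [k4 [k5 E]]]]] := rel Sx.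
(* Dividing by [1 - a b] brings the [dx] coefficient to the shape expected by the structure
   equations. *)
have [m K1E] : exists m, K1 = - m * (1 - a x * b x).
  by exists (- K1 / (1 - a x * b x)); rewrite !mulNr opprK divfK // ab1.
subst K1.
exists (- k3 *: grad fy x), (- k4 *: grad fy x), (grad a x - (k5 - a x * k4) *: grad fy x), m.
exists (- k3 *: grad fx x), (- k4 *: grad fx x), (- (k5 - a x * k4) *: grad fx x).
exists ((K2 + b x * m) *: grad fy x), (- b x *: grad fx x).
split; last by rewrite evalfDl evalfNl evalfZl ey mulr0 subr0.
- rewrite (d1D oS sw2 (smooth_mapZ oS sa sw3) Sx) (d1Z oS sa sw3 Sx) !d1_contact //.
  exact: structure_equation2 E.
- by rewrite d1_contact //; exact: structure_equation3 E.
Qed.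

Let IFP eta : IF Sigma i eta <-> smooth_map_on Sigma eta /\
  exists g1 g2 g3, [/\ smooth_on Sigma g1, smooth_on Sigma g2, smooth_on Sigma g3 &
    forall x, Sigma x -> eta x = g1 x *: w1 x + g2 x *: B x + g3 x *: w3 x].
Proof.
have sub (f2 f3 : 'rV[R]_7 -> R) : smooth_on Sigma f2 -> smooth_on Sigma f3 ->
    smooth_on Sigma (fun x => f3 x - a x * f2 x).
  by move=> s2 s3; apply: smoothB => //; exact: smoothM.
have add (f2 f3 : 'rV[R]_7 -> R) : smooth_on Sigma f2 -> smooth_on Sigma f3 ->
    smooth_on Sigma (fun x => f3 x + a x * f2 x).
  by move=> s2 s3; apply: smoothD => //; exact: smoothM.
have e1 (c1 c2 c3 k : R) (u v w : 'rV[R]_7) :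
    c1 *: u + c2 *: v + c3 *: w = c1 *: u + c2 *: (v + k *: w) + (c3 - k * c2) *: w.
  by apply/rowP => j; rewrite !mxE; ring.
have e2 (c1 c2 c3 k : R) (u v w : 'rV[R]_7) :
    c1 *: u + c2 *: (v + k *: w) + c3 *: w = c1 *: u + c2 *: v + (c3 + k * c2) *: w.
  by apply/rowP => j; rewrite !mxE; ring.
split=> -[seta [f1 [f2 [f3 [s1 s2 s3 H]]]]]; split=> //; case: pb23 => pb.
- exists f1, f2, (fun x => f3 x - a x * f2 x); split => // [|x Sx]; first exact: sub.
  by have [p2 p3] := pb x Sx; rewrite H // pb1 // p2 p3; exact: e1.
- exists f1, f3, (fun x => f2 x - a x * f3 x); split => // [|x Sx]; first exact: sub.
  by have [p2 p3] := pb x Sx; rewrite H // pb1 // p2 p3 addrAC; exact: e1.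
- exists f1, f2, (fun x => f3 x + a x * f2 x); split => // [|x Sx]; first exact: add.
  by have [p2 p3] := pb x Sx; rewrite H // pb1 // p2 p3; exact: e2.
- exists f1, (fun x => f3 x + a x * f2 x), f2; split => // [|x Sx]; first exact: add.
  by have [p2 p3] := pb x Sx; rewrite H // pb1 // p2 p3 [RHS]addrAC; exact: e2.
Qed.

Let spanw x : Sigma x ->
  let W := in_span3 (pullback i (@theta1 R) x) (pullback i (@theta2 R) x) (pullback i (@theta3 R) x) in
  [/\ W (w1 x), W (B x) & W (w3 x)].
Proof.
move=> Sx W; rewrite /W pb1 //; case: pb23 => /(_ x Sx)[-> ->]; split.
- by exists 1, 0, 0; rewrite !scale0r !addr0 scale1r.
- by exists 0, 1, (a x); rewrite scale0r add0r scale1r.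
- by exists 0, 0, 1; rewrite !scale0r !add0r scale1r.
- by exists 1, 0, 0; rewrite !scale0r !addr0 scale1r.
- by exists 0, (a x), 1; rewrite scale0r add0r scale1r addrC.
- by exists 0, 1, 0; rewrite !scale0r add0r addr0 scale1r.
Qed.

Let kerw x u : Sigma x -> evalf (pullback i (@theta1 R) x) u = 0 ->
  evalf (pullback i (@theta2 R) x) u = 0 -> evalf (pullback i (@theta3 R) x) u = 0 ->
  [/\ evalf (w1 x) u = 0, evalf (B x) u = 0 & evalf (w3 x) u = 0].
Proof.
by move=> Sx; rewrite pb1 // /B evalfDl evalfZl; case: pb23 => /(_ x Sx)[-> ->] -> -> ->;
  rewrite mulr0 addr0.
Qed.

Lemma characteristic_free x c1 c2 c3 : Sigma x ->
  c1 *: w1 x + c2 *: B x + c3 *: w3 x = 0 -> c2 = 0 /\ c3 = 0.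
Proof.
move=> Sx E; have H := coframe_free characteristic_coframe (cs := [:: c1; c2; c3]) Sx.
rewrite !big_ord_recl big_ord0 /= !scale0r !addr0 addrA in H.
by split; [exact: H E (@Ordinal 7 1 isT)|exact: H E (@Ordinal 7 2 isT)].
Qed.

Lemma characteristic_system :
  [/\ max_isotropic2 Sigma i (subsystem Sigma w1 B), subsystem Sigma w1 B B &
  exists e : 'rV[R]_7 -> 'rV[R]_7,
  [/\ class_is Sigma (subsystem Sigma w1 B) 6 <->
        (forall x, Sigma x -> evalf (grad a x) (e x) = 0),
      class_is Sigma (subsystem Sigma w1 B) 7 <->
        (forall x, Sigma x -> evalf (grad a x) (e x) <> 0) &
      forall x, Sigma x ->
        [/\ evalf (grad fx x) (e x) = 0, evalf (grad fy x) (e x) = 0,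
            evalf (grad fz x) (e x) = 0, evalf (grad fp x) (e x) = 0
          & evalf (grad fq x) (e x) = 0] /\
        [/\ evalf (grad fr x) (e x) = a x ^+ 2, evalf (grad fs x) (e x) = - a x
          & evalf (grad ft x) (e x) = 1]]].
Proof.
pose e := dual w1 B w3 S T P Q (@Ordinal 7 6 isT).
have He x : Sigma x ->
  [/\ evalf (grad fx x) (e x) = 0, evalf (grad fy x) (e x) = 0,
      evalf (grad fz x) (e x) = 0, evalf (grad fp x) (e x) = 0
    & evalf (grad fq x) (e x) = 0] /\
  [/\ evalf (grad fr x) (e x) = a x ^+ 2, evalf (grad fs x) (e x) = - a x
    & evalf (grad ft x) (e x) = 1].
  move=> Sx; have [[e1 e2 e3] [e4 e5 e6 e7]] := evalf_last_dual characteristic_coframe Sx.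
  have [h [h1 h2]] := characteristic_vector Sx e1 e2 e3 e4 e5 e6.
  by split=> //; split; [rewrite h1 e7 mulr1|rewrite h2 e7 mulr1|].
have sBC x (Sx : Sigma x) : _ := @structBC e x Sx (let: conj (And5 _ ey _ _ _) _ := He x Sx in ey).
split; last 1 first.
- exists e; split=> //.
    exact: (subsystem_class6 oS sw1 sB sw3 sS sT sP sQ characteristic_coframe structA sBC).
  exact: (subsystem_class7 oS sw1 sB sw3 sS sT sP sQ characteristic_coframe structA sBC).
- exact: (subsystem_max_isotropic oS sw1 sB sw3 sS sT sP sQ characteristic_coframe
    IFP spanw kerw structA sBC).
- exact: subsystemB.
Qed.

End Characteristic.

(** * Hyperbolic equations *)

Section Hyperbolic.
Set Implicit Arguments.
Unset Strict Implicit.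
Variables (R : realType) (U : set 'rV[R]_8) (F : 'rV[R]_8 -> R)
  (Sigma : set 'rV[R]_7) (i : 'rV[R]_7 -> 'rV[R]_8).
Hypotheses (oU : open U) (sF : smooth_on U F) (oS : open Sigma)
  (si : smooth_map_on Sigma i) (iU : forall x, Sigma x -> U (i x))
  (hyp : hyperbolic F Sigma i)
  (Fs_ge0 : forall x, Sigma x -> 0 <= partial js F (i x)).

Lemma open_pos (m : nat) (V : set 'rV[R]_m) (f : 'rV[R]_m -> R) : open V ->
  smooth_on V f -> open [set w | V w /\ 0 < f w].
Proof.
move=> oV sf; rewrite openE => w [Vw fw].
have cf : {for w, continuous f} := differentiable_continuous (smooth_diff sf Vw).
have n1 : \forall y \near w, V y by exact: open_nbhs_nbhs.
have n2 : \forall y \near w, 0 < f y by exact: (cf _ (lt_nbhsr fw)).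
exact: filterI n1 n2.
Qed.

Lemma det_mx3 (a b c d e f g h k : R) :
  \det (mx3 [:: [:: a; b; c]; [:: d; e; f]; [:: g; h; k]]) =
  a * (e * k - f * h) - b * (d * k - f * g) + c * (d * h - e * g).
Proof.
rewrite (expand_det_row _ ord0) !big_ord_recl big_ord0 /cofactor.
rewrite !(expand_det_row _ ord0) !big_ord_recl !big_ord0 /cofactor !det_mx11 !mxE /=.
ring.
Qed.

Lemma sum_vertical (h g : 'I_8 -> R) : g jx = 0 -> g jy = 0 -> g jz = 0 -> g jp = 0 ->
  g jq = 0 -> \sum_j h j * g j = h jr * g jr + h js * g js + h jt * g jt.
Proof.
move=> g0 g1 g2 g3 g4; rewrite !big_ord_recl big_ord0 addr0.
have E (j k : 'I_8) c : val j = val k -> g j = c -> g k = c by move=> /val_inj ->.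
rewrite (E jx _ 0) // (E jy _ 0) // (E jz _ 0) // (E jp _ 0) // (E jq _ 0) //.
rewrite !mulr0 !add0r addrA.
by congr (h _ * g _ + h _ * g _ + h _ * g _); exact: val_inj.
Qed.

(** [l] is the larger root of [X^2 - f2 X + f1 f3], and the quotient of the other root by [l] is
    [a b]. The sum of the roots gives the first identity, and their difference [2 s] gives
    [1 - a b = 2 s / l]. *)
Lemma symbol_roots (l s f1 f2 f3 : R) : l = f2 / 2 + s -> 0 < s -> 0 < l ->
  s ^+ 2 = 4^-1 * f2 ^+ 2 - f1 * f3 ->
  f2 = l * (1 + f3 / l * (f1 / l)) /\ 1 - f3 / l * (f1 / l) != 0.
Proof.
move=> lE s0 l0 sE; have ln0 : l != 0 by rewrite gt_eqF.
have E : f1 * f3 = l * f2 - l ^+ 2.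
  by rewrite (_ : f1 * f3 = 4^-1 * f2 ^+ 2 - s ^+ 2); [rewrite lE; field|rewrite sE subKr].
have E2 : f3 / l * (f1 / l) = f2 / l - 1.
  by rewrite mulrACA (mulrC f3) E; field; exact: ln0.
rewrite E2 (_ : 1 - _ = 2 * s / l); last first.
  by have f2E : f2 = 2 * (l - s); [rewrite lE; field|rewrite f2E; field; exact: ln0].
split; first by field; exact: ln0.
by rewrite gt_eqF // divr_gt0 // mulr_gt0.
Qed.

Let disc w := 4^-1 * partial js F w ^+ 2 - partial jr F w * partial jt F w.
Let V0 := [set w | U w /\ 0 < disc w].
Let lam := lambda_plus F.
(** Hyperbolicity and [F_s >= 0] are assumed on the locus only. [V] is an open set containing the
    locus, on which [lambda_plus] is smooth and positive, so that the quotients can be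
    differentiated in all jet directions. *)
Let V := [set w | V0 w /\ 0 < lam w].

Let sdisc : smooth_on U disc.
Proof.
by apply: smoothB => //; apply: smoothM => //; do ?apply: smoothM => //;
  first [exact: smooth_cst|exact: smooth_partial].
Qed.

Let oV0 : open V0. Proof. exact: open_pos. Qed.
Let V0U : V0 `<=` U. Proof. by move=> w []. Qed.

Let lamE w : V0 w -> lam w = partial js F w / 2 + Num.sqrt (disc w).
Proof.
move=> [_ dw]; rewrite /lam /lambda_plus -[X in `|X|]opprB normrN ger0_norm //.
exact: ltW.
Qed.

Let slam0 : smooth_on V0 lam.
Proof.
have s1 : smooth_on V0 (fun w => partial js F w * 2^-1 + Num.sqrt (disc w)).
  apply: smoothD => //; last first.
    by apply: smooth_sqrt => // [w []//|]; exact: smooth_subset sdisc.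
  apply: smoothM => //; last exact: smooth_cst.
  by apply: smooth_subset (smooth_partial _ sF).
by apply: smooth_eq s1 => // w Vw; rewrite lamE.
Qed.

Let oV : open V. Proof. exact: open_pos. Qed.
Let VV0 : V `<=` V0. Proof. by move=> w []. Qed.

Let iV x : Sigma x -> V (i x).
Proof.
move=> Sx; have d0 : 0 < disc (i x) by rewrite -oppr_lt0 opprB; exact: hyp.
have v0 : V0 (i x) by split; [exact: iU|].
split=> //; rewrite lamE // ltr_wpDl ?sqrtr_gt0 //.
by rewrite divr_ge0 ?Fs_ge0.
Qed.

Definition mu_t w := partial jt F w / lam w.
Definition mu_r w := partial jr F w / lam w.

Let smu (j : 'I_8) : smooth_on V (fun w => partial j F w / lam w).
Proof.
apply: smoothM => //.
  by apply: smooth_subset (smooth_partial _ sF) => w [[]].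
apply: smoothV => //; first by move=> w [_ /lt0r_neq0].
exact: smooth_subset slam0.
Qed.

Lemma lambda_plus_gt0 x : Sigma x -> 0 < lam (i x).
Proof. by move=> /iV[]. Qed.

Lemma symbol_factor x : Sigma x ->
  [/\ partial jr F (i x) = lam (i x) * mu_r (i x),
      partial js F (i x) = lam (i x) * (1 + mu_t (i x) * mu_r (i x)),
      partial jt F (i x) = lam (i x) * mu_t (i x) &
      1 - mu_t (i x) * mu_r (i x) != 0].
Proof.
move=> Sx; have [v0 l0] := iV Sx; have ln0 : lam (i x) != 0 by rewrite gt_eqF.
have d0 := v0.2; have sd0 : 0 < Num.sqrt (disc (i x)) by rewrite sqrtr_gt0.
have [h1 h2] := symbol_roots (lamE v0) sd0 l0 (sqr_sqrtr (ltW d0)).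
by split; [rewrite mulrC divfK|exact: h1|rewrite mulrC divfK|exact: h2].
Qed.

Let smooth_pullback (f : 'rV[R]_8 -> R) : smooth_on V f -> smooth_on Sigma (fun x => f (i x)).
Proof.
move=> sf; apply/smooth_onP => k; apply: (@Ck_comp _ _ _ Sigma V) => // [j|].
  by apply/smooth_onP: k; exact: si.
by apply/smooth_onP: k.
Qed.

Lemma smooth_mu_t : smooth_on Sigma (fun x => mu_t (i x)).
Proof. exact: smooth_pullback (smu jt). Qed.

Lemma smooth_mu_r : smooth_on Sigma (fun x => mu_r (i x)).
Proof. exact: smooth_pullback (smu jr). Qed.

Lemma evalf_grad_comp (f : 'rV[R]_8 -> R) x u : Sigma x -> differentiable f (i x) ->
  evalf (grad (fun y => f (i y)) x) u =
  \sum_j partial j f (i x) * evalf (grad (fun y => i y 0 j) x) u.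
Proof.
move=> Sx df; rewrite evalfE; under [RHS]eq_bigr do rewrite evalfE mulr_sumr.
rewrite exchange_big; apply: eq_bigr => k _; rewrite mxE partial_comp //.
  by rewrite mulr_suml; apply: eq_bigr => j _; rewrite mxE mulrCA mulrA.
by move=> j; exact: smooth_diff (si j) Sx.
Qed.

(** The image of [u] under the differential of [i] is tangent to the fibre of [J^2 -> J^1], with
    fibre components [r, s, t]. *)
Definition vertical_vector x u (r s t : R) := [/\ evalf (grad (fun y => i y 0 jx) x) u = 0,
    evalf (grad (fun y => i y 0 jy) x) u = 0, evalf (grad (fun y => i y 0 jz) x) u = 0,
    evalf (grad (fun y => i y 0 jp) x) u = 0 & evalf (grad (fun y => i y 0 jq) x) u = 0] /\
  [/\ evalf (grad (fun y => i y 0 jr) x) u = r, evalf (grad (fun y => i y 0 js) x) u = s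
    & evalf (grad (fun y => i y 0 jt) x) u = t].

Let evalf_vertical f x u r s t : Sigma x -> smooth_on V f -> vertical_vector x u r s t ->
  evalf (grad (fun y => f (i y)) x) u =
  partial jr f (i x) * r + partial js f (i x) * s + partial jt f (i x) * t.
Proof.
move=> Sx sf [[e1 e2 e3 e4 e5] [e6 e7 e8]].
rewrite evalf_grad_comp //; last exact: smooth_diff sf (iV Sx).
rewrite (sum_vertical (fun j => partial j f (i x)) e1 e2 e3 e4 e5).
by rewrite e6 e7 e8.
Qed.

(** The cofactors of the third row are [- lambda^2] times [(a^2, -a, 1)], the last because
    [F_r F_t - lambda F_s = - lambda^2]. The determinant is therefore a derivative along [u]. *)
Lemma I1tildeE x u : Sigma x ->
  vertical_vector x u (mu_t (i x) ^+ 2) (- mu_t (i x)) 1 ->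
  I1tilde F (i x) = - lam (i x) ^+ 2 * evalf (grad (fun y => mu_t (i y)) x) u.
Proof.
move=> Sx vu; have -> := evalf_vertical Sx (smu jt) vu.
have -> : I1tilde F (i x) = \det (mx3 [::
  [:: partial jr F (i x); partial js F (i x); partial jt F (i x)];
  [:: lam (i x); partial jt F (i x); 0];
  [:: partial jr mu_t (i x); partial js mu_t (i x); partial jt mu_t (i x)]]) by [].
rewrite det_mx3 -/mu_t.
move: (partial jr mu_t (i x)) (partial js mu_t (i x)) (partial jt mu_t (i x)) => m1 m2 m3.
have [-> -> -> _] := symbol_factor Sx; ring.
Qed.

Lemma I2tildeE x u : Sigma x ->
  vertical_vector x u 1 (- mu_r (i x)) (mu_r (i x) ^+ 2) ->
  I2tilde F (i x) = - lam (i x) ^+ 2 * evalf (grad (fun y => mu_r (i y)) x) u.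
Proof.
move=> Sx vu; have -> := evalf_vertical Sx (smu jr) vu.
have -> : I2tilde F (i x) = \det (mx3 [::
  [:: 0; partial jr F (i x); lam (i x)];
  [:: partial jr F (i x); partial js F (i x); partial jt F (i x)];
  [:: partial jr mu_r (i x); partial js mu_r (i x); partial jt mu_r (i x)]]) by [].
rewrite det_mx3 -/mu_r.
move: (partial jr mu_r (i x)) (partial js mu_r (i x)) (partial jt mu_r (i x)) => m1 m2 m3.
have [-> -> -> _] := symbol_factor Sx; ring.
Qed.

End Hyperbolic.

(** * The two isotropic systems of a parametrized equation *)

Section Parametrization.
Set Implicit Arguments.
Unset Strict Implicit.
Variables (R : realType) (U : set 'rV[R]_8) (F : 'rV[R]_8 -> R)
  (Sigma : set 'rV[R]_7) (i : 'rV[R]_7 -> 'rV[R]_8).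
Hypotheses (oU : open U) (sF : smooth_on U F) (oS : open Sigma)
  (si : smooth_map_on Sigma i) (iU : forall x, Sigma x -> U (i x))
  (hyp : hyperbolic F Sigma i)
  (Fs_ge0 : forall x, Sigma x -> 0 <= partial js F (i x)).
Hypotheses (rankJ : forall x, Sigma x -> \rank ('J i x) = 7%N)
  (Fi0 : forall x, Sigma x -> F (i x) = 0).

Let co (j : 'I_8) := fun x : 'rV[R]_7 => i x 0 j.
Let a x := mu_t F (i x).
Let b x := mu_r F (i x).

Lemma dcoord_pullback x j : Sigma x -> dcoord R j *m ('J i x)^T = grad (co j) x.
Proof.
move=> Sx; have di : differentiable i x.
  by apply: differentiable_row => k; exact: smooth_diff (si k) Sx.
by rewrite -rowE; apply/rowP => k; rewrite !mxE -jacobianE // mxE.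
Qed.

Let pullbackE x : Sigma x ->
  [/\ pullback i (@theta1 R) x = contact (co jz) (co jp) (co jx) (co jq) (co jy) x,
      pullback i (@theta2 R) x = contact (co jp) (co jr) (co jx) (co js) (co jy) x
    & pullback i (@theta3 R) x = contact (co jq) (co js) (co jx) (co jt) (co jy) x].
Proof.
move=> Sx; rewrite /pullback /theta1 /theta2 /theta3 /contact.
by rewrite !mulmxBl -!scalemxAl !dcoord_pullback.
Qed.

Let grad_span x u : Sigma x -> (forall j, evalf (grad (co j) x) u = 0) -> u = 0.
Proof.
move=> Sx H; have fr : row_free ('J i x) by rewrite /row_free rankJ.
apply: (row_free_inj fr); rewrite mul0mx; apply/rowP => j; rewrite [RHS]mxE -[RHS](H j).
rewrite -dcoord_pullback // -rowE evalfE mxE; apply: eq_bigr => k _.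
by rewrite !mxE mulrC.
Qed.

Lemma sum8 (V : nmodType) (G : 'I_8 -> V) :
  \sum_j G j = G jx + G jy + G jz + G jp + G jq + G jr + G js + G jt.
Proof.
rewrite !big_ord_recl big_ord0 addr0 !addrA.
by do ?congr (_ + _); congr (G _); exact: val_inj.
Qed.

Let tangency x : Sigma x -> \sum_j partial j F (i x) *: grad (co j) x = 0.
Proof.
move=> Sx; apply/rowP => k; rewrite [RHS]mxE.
have <- : partial k (fun y => F (i y)) x = 0.
  by rewrite (eq_partial k oS Fi0 Sx) partial_cst.
rewrite partial_comp; first by rewrite summxE; apply: eq_bigr => j _; rewrite !mxE mulrC.
  by move=> j; exact: smooth_diff (si j) Sx.
by exact: smooth_diff sF (iU Sx).
Qed.

(** Divides [dF = 0] by [lambda] after replacing [dz, dp, dq] by contact forms; the replacement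
    feeds [p, q, r, s, t] into the coefficients of [dx] and [dy]. *)
Lemma symbol_relation (dx dy dz dp dq dr ds dt : 'rV[R]_7)
    (cx cy cz cp cq l m1 m2 p q r s t : R) : l != 0 ->
  cx *: dx + cy *: dy + cz *: dz + cp *: dp + cq *: dq + (l * m2) *: dr +
    (l * (1 + m1 * m2)) *: ds + (l * m1) *: dt = 0 ->
  exists K1 K2 k3 k4 k5, m2 *: dr + (1 + m1 * m2) *: ds + m1 *: dt +
    (K1 *: dx + K2 *: dy + k3 *: (dz - p *: dx - q *: dy) +
     k4 *: (dp - r *: dx - s *: dy) + k5 *: (dq - s *: dx - t *: dy)) = 0.
Proof.
move=> l0 E.
exists ((cx + cz * p + cp * r + cq * s) / l), ((cy + cz * q + cp * s + cq * t) / l).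
exists (cz / l), (cp / l), (cq / l); rewrite -[RHS](scaler0 _ (l^-1)) -E.
by apply/rowP => j; rewrite !mxE; field.
Qed.

Let l0 x : Sigma x -> lambda_plus F (i x) != 0.
Proof. by move=> Sx; rewrite gt_eqF // (lambda_plus_gt0 iU hyp Fs_ge0). Qed.

Let rel_t x : Sigma x -> exists K1 K2 k3 k4 k5,
  b x *: grad (co jr) x + (1 + a x * b x) *: grad (co js) x + a x *: grad (co jt) x +
  (K1 *: grad (co jx) x + K2 *: grad (co jy) x +
   k3 *: contact (co jz) (co jp) (co jx) (co jq) (co jy) x +
   k4 *: contact (co jp) (co jr) (co jx) (co js) (co jy) x +
   k5 *: contact (co jq) (co js) (co jx) (co jt) (co jy) x) = 0.
Proof.
move=> Sx; apply: (symbol_relation _ _ _ _ _ (l0 Sx)).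
have [<- <- <- _] := symbol_factor iU hyp Fs_ge0 Sx.
by rewrite -[RHS](tangency Sx) sum8.
Qed.

Let rel_r x : Sigma x -> exists K1 K2 k3 k4 k5,
  a x *: grad (co jt) x + (1 + b x * a x) *: grad (co js) x + b x *: grad (co jr) x +
  (K1 *: grad (co jy) x + K2 *: grad (co jx) x +
   k3 *: contact (co jz) (co jq) (co jy) (co jp) (co jx) x +
   k4 *: contact (co jq) (co jt) (co jy) (co js) (co jx) x +
   k5 *: contact (co jp) (co js) (co jy) (co jr) (co jx) x) = 0.
Proof.
move=> Sx; apply: (@symbol_relation _ _ _ _ _ _ _ _ (partial jy F (i x))
  (partial jx F (i x)) (partial jz F (i x)) (partial jq F (i x)) (partial jp F (i x))
  _ _ _ _ _ _ _ _ (l0 Sx)).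
have [<- E <- _] := symbol_factor iU hyp Fs_ge0 Sx.
rewrite (mulrC (mu_r F (i x))) -E -[RHS](tangency Sx) sum8.
by rewrite [RHS]+%R.[ACl 2*1*3*5*4*8*7*6].
Qed.

(* [form_r] and [system_r] arise from [form_t] and [system_t] by the exchange
   x <-> y, p <-> q, r <-> t. *)
Definition form_t : 'rV[R]_7 -> 'rV[R]_7 := fun x =>
  contact (co jp) (co jr) (co jx) (co js) (co jy) x +
  a x *: contact (co jq) (co js) (co jx) (co jt) (co jy) x.
Definition form_r : 'rV[R]_7 -> 'rV[R]_7 := fun x =>
  contact (co jq) (co jt) (co jy) (co js) (co jx) x +
  b x *: contact (co jp) (co js) (co jy) (co jr) (co jx) x.
Definition system_t := subsystem Sigma (contact (co jz) (co jp) (co jx) (co jq) (co jy)) form_t.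
Definition system_r := subsystem Sigma (contact (co jz) (co jq) (co jy) (co jp) (co jx)) form_r.

Let contactC f h1 k1 h2 k2 x : contact f h1 k1 h2 k2 x = contact f h2 k2 h1 k1 x :> 'rV[R]_7.
Proof. exact: addrAC. Qed.

Let sco j : smooth_on Sigma (co j). Proof. exact: si. Qed.
Let sa : smooth_on Sigma a. Proof. exact: (smooth_mu_t oU sF oS si iU hyp Fs_ge0). Qed.
Let sb : smooth_on Sigma b. Proof. exact: (smooth_mu_r oU sF oS si iU hyp Fs_ge0). Qed.

Let span_t x u : Sigma x ->
  (forall f, f \in [:: co jx; co jy; co jz; co jp; co jq; co jr; co js; co jt] ->
    evalf (grad f x) u = 0) -> u = 0.
Proof.
move=> Sx H; apply: (grad_span Sx) => j; apply: H.
have E k : val j = val k -> co j = co k by move=> /val_inj ->.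
by case: j E => -[|[|[|[|[|[|[|[|j]]]]]]]] // j8 E;
  [rewrite (E jx)|rewrite (E jy)|rewrite (E jz)|rewrite (E jp)|rewrite (E jq)
  |rewrite (E jr)|rewrite (E js)|rewrite (E jt)]; rewrite // !inE eqxx ?orbT.
Qed.

Let span_r x u : Sigma x ->
  (forall f, f \in [:: co jy; co jx; co jz; co jq; co jp; co jt; co js; co jr] ->
    evalf (grad f x) u = 0) -> u = 0.
Proof.
move=> Sx H; apply: (span_t Sx) => f Hf; apply: H; move: Hf; rewrite !inE.
by do !(case/orP => [->|]; rewrite ?orbT //); move=> ->; rewrite ?orbT.
Qed.

Let ab1 x : Sigma x -> 1 - a x * b x != 0.
Proof. by move=> Sx; have [] := symbol_factor iU hyp Fs_ge0 Sx. Qed.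
Let ba1 x : Sigma x -> 1 - b x * a x != 0.
Proof. by rewrite mulrC; exact: ab1. Qed.

(** As [lambda_plus] does not vanish, [I1tilde] and [da(e)] have the same zeros. The field [e] stays
    in the conclusion because the scaling law needs a tangent vector with these fibre components. *)
Lemma system_tP :
  [/\ max_isotropic2 Sigma i system_t, system_t form_t & exists e : 'rV[R]_7 -> 'rV[R]_7,
  [/\ class_is Sigma system_t 6 <-> (forall x, Sigma x -> I1tilde F (i x) = 0),
      class_is Sigma system_t 7 <-> (forall x, Sigma x -> I1tilde F (i x) <> 0)
    & forall x, Sigma x ->
        vertical_vector i x (e x) (mu_t F (i x) ^+ 2) (- mu_t F (i x)) 1]].
Proof.
have pb1 x (Sx : Sigma x) : pullback i (@theta1 R) x = _ := let: And3 h _ _ := pullbackE Sx in h.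
have pb23 : (forall x, Sigma x ->
    pullback i (@theta2 R) x = contact (co jp) (co jr) (co jx) (co js) (co jy) x /\
    pullback i (@theta3 R) x = contact (co jq) (co js) (co jx) (co jt) (co jy) x).
  by move=> x /pullbackE[].
have [h1 h2 [e [h6 h7 he]]] := characteristic_system oS (sco jx) (sco jy) (sco jz) (sco jp)
  (sco jq) (sco jr) (sco js) (sco jt) sa sb ab1 rel_t span_t pb1 (or_introl pb23).
split=> //; exists e.
have ve x : Sigma x -> vertical_vector i x (e x) (mu_t F (i x) ^+ 2) (- mu_t F (i x)) 1.
  by move=> /he.
have E x (Sx : Sigma x) := I1tildeE oU sF si iU hyp Fs_ge0 Sx (ve x Sx).
split=> //.
  apply: (iff_trans h6); split=> H x Sx; first by rewrite E // H // mulr0.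
  have /eqP := H x Sx; rewrite E // mulNr oppr_eq0 mulf_eq0 expf_eq0 /= (negPf (l0 Sx)).
  by move/eqP.
apply: (iff_trans h7); split=> H x Sx.
  rewrite E // => /eqP; rewrite mulNr oppr_eq0 mulf_eq0 expf_eq0 /= (negPf (l0 Sx)) /=.
  by move/eqP; exact: H.
by move=> g0; apply: (H x Sx); rewrite E // g0 mulr0.
Qed.

Lemma system_rP :
  [/\ max_isotropic2 Sigma i system_r, system_r form_r & exists e : 'rV[R]_7 -> 'rV[R]_7,
  [/\ class_is Sigma system_r 6 <-> (forall x, Sigma x -> I2tilde F (i x) = 0),
      class_is Sigma system_r 7 <-> (forall x, Sigma x -> I2tilde F (i x) <> 0)
    & forall x, Sigma x ->
        vertical_vector i x (e x) 1 (- mu_r F (i x)) (mu_r F (i x) ^+ 2)]].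
Proof.
have pb1 x : Sigma x -> pullback i (@theta1 R) x =
    contact (co jz) (co jq) (co jy) (co jp) (co jx) x.
  by move=> /pullbackE[-> _ _]; exact: contactC.
have pb23 : (forall x, Sigma x ->
    pullback i (@theta2 R) x = contact (co jp) (co js) (co jy) (co jr) (co jx) x /\
    pullback i (@theta3 R) x = contact (co jq) (co jt) (co jy) (co js) (co jx) x).
  by move=> x /pullbackE[_ -> ->]; split; exact: contactC.
have [h1 h2 [e [h6 h7 he]]] := characteristic_system oS (sco jy) (sco jx) (sco jz) (sco jq)
  (sco jp) (sco jt) (sco js) (sco jr) sb sa ba1 rel_r span_r pb1 (or_intror pb23).
split=> //; exists e.
have ve x : Sigma x -> vertical_vector i x (e x) 1 (- mu_r F (i x)) (mu_r F (i x) ^+ 2).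
  by move=> /he[[e1 e2 e3 e4 e5] [e6 e7 e8]].
have E x (Sx : Sigma x) := I2tildeE oU sF si iU hyp Fs_ge0 Sx (ve x Sx).
split=> //.
  apply: (iff_trans h6); split=> H x Sx; first by rewrite E // H // mulr0.
  have /eqP := H x Sx; rewrite E // mulNr oppr_eq0 mulf_eq0 expf_eq0 /= (negPf (l0 Sx)).
  by move/eqP.
apply: (iff_trans h7); split=> H x Sx.
  rewrite E // => /eqP; rewrite mulNr oppr_eq0 mulf_eq0 expf_eq0 /= (negPf (l0 Sx)) /=.
  by move/eqP; exact: H.
by move=> g0; apply: (H x Sx); rewrite E // g0 mulr0.
Qed.

(** If [w2 + a w3] were a combination of [w1] and [w3 + b w2], comparing coefficients would give
    [a b = 1]. *)
Lemma system_t_neq_r x : Sigma x -> system_t <> system_r.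
Proof.
move=> Sx tr; have : system_r form_t by rewrite -tr; have [] := system_tP.
move=> [_ /(_ x Sx)[k1 [k2]]]; rewrite /form_r /form_t.
have -> := contactC (co jz) (co jq) (co jy) (co jp) (co jx) x.
have -> := contactC (co jq) (co jt) (co jy) (co js) (co jx) x.
have -> := contactC (co jp) (co js) (co jy) (co jr) (co jx) x.
have free := characteristic_free ab1 rel_t span_t Sx.
move: free; move: (contact _ _ _ _ _ x) (contact _ _ _ _ _ x) (contact _ _ _ _ _ x).
move=> c3 c2 c1 free E.
(* Coefficients of the difference in the basis [w1], [w2 + a w3], [w3]. *)
have [|h1 /eqP] := free (- k1) (1 - k2 * b x) (- k2 * (1 - a x * b x)).
  rewrite -[RHS](subrr (c2 + a x *: c3)) {3}E.
  by apply/rowP => j; rewrite !mxE; ring.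
rewrite mulf_eq0 oppr_eq0 (negPf (ab1 Sx)) orbF => /eqP k20.
by move/eqP: h1; rewrite k20 mul0r subr0 oner_eq0.
Qed.

End Parametrization.

(** * Multiplication of the equation by a positive function *)

Section Rescaling.
Set Implicit Arguments.
Unset Strict Implicit.
Variables (R : realType) (U : set 'rV[R]_8) (F phi : 'rV[R]_8 -> R)
  (Sigma : set 'rV[R]_7) (i : 'rV[R]_7 -> 'rV[R]_8).
Hypotheses (oU : open U) (sF : smooth_on U F) (sphi : smooth_on U phi) (oS : open Sigma)
  (si : smooth_map_on Sigma i) (iU : forall x, Sigma x -> U (i x))
  (hyp : hyperbolic F Sigma i)
  (Fs_ge0 : forall x, Sigma x -> 0 <= partial js F (i x)).
Hypotheses (rankJ : forall x, Sigma x -> \rank ('J i x) = 7%N)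
  (Fi0 : forall x, Sigma x -> F (i x) = 0)
  (phi0 : forall x, Sigma x -> 0 < phi (i x)).

Let G w := phi w * F w.

Let partialG j x : Sigma x -> partial j G (i x) = phi (i x) * partial j F (i x).
Proof.
move=> Sx; rewrite partialM; [|exact: smooth_diff sphi (iU Sx)|exact: smooth_diff sF (iU Sx)].
by rewrite Fi0 // mul0r addr0.
Qed.

Let lambdaG x : Sigma x -> lambda_plus G (i x) = phi (i x) * lambda_plus F (i x).
Proof.
move=> Sx; rewrite /lambda_plus !partialG //; have p0 := phi0 Sx.
move: (partial jr F _) (partial js F _) (partial jt F _) p0 => r s t.
move: (phi _) => p p0.
have -> : p * r * (p * t) - 4^-1 * (p * s) ^+ 2 = p ^+ 2 * (r * t - 4^-1 * s ^+ 2) by ring.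
by rewrite normrM (ger0_norm (sqr_ge0 p)) sqrtrM ?sqr_ge0 // sqrtr_sqr (gtr0_norm p0) mulrDr mulrA.
Qed.

(** The quotients for [G] and [F] agree only on the locus, so their jet derivatives cannot be
    compared one by one. Rewriting both invariants as derivatives along one tangent vector leaves
    only the square of [lambda_plus] to scale. *)
Lemma I_tilde_rescale x : Sigma x ->
  I1tilde G (i x) = phi (i x) ^+ 2 * I1tilde F (i x) /\
  I2tilde G (i x) = phi (i x) ^+ 2 * I2tilde F (i x).
Proof.
move=> Sx; have sG : smooth_on U G by exact: smoothM.
have hypG : hyperbolic G Sigma i.
  move=> y Sy; rewrite !partialG //; have := hyp Sy; have := phi0 Sy.
  move: (partial jr F _) (partial js F _) (partial jt F _) => r s t p0 h.
  have -> : phi (i y) * r * (phi (i y) * t) - 4^-1 * (phi (i y) * s) ^+ 2 =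
    phi (i y) ^+ 2 * (r * t - 4^-1 * s ^+ 2) by ring.
  by rewrite pmulr_rlt0 // exprn_gt0.
have Gs_ge0 y : Sigma y -> 0 <= partial js G (i y).
  by move=> Sy; rewrite partialG // mulr_ge0 ?Fs_ge0 // ltW ?phi0.
have muG j y : Sigma y -> partial j G (i y) / lambda_plus G (i y) =
    partial j F (i y) / lambda_plus F (i y).
  by move=> Sy; rewrite partialG // lambdaG // -mulf_div divff ?mul1r // gt_eqF ?phi0.
have gradE (f g : 'rV[R]_8 -> R) : (forall y, Sigma y -> f (i y) = g (i y)) ->
    grad (fun y => f (i y)) x = grad (fun y => g (i y)) x.
  by move=> H; apply/rowP => k; rewrite !mxE; exact: eq_partial oS H Sx.
have muGt y : Sigma y -> mu_t G (i y) = mu_t F (i y) := muG jt y.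
have muGr y : Sigma y -> mu_r G (i y) = mu_r F (i y) := muG jr y.
have [_ _ [e1 [_ _ /(_ x Sx) v1]]] := system_tP oU sF oS si iU hyp Fs_ge0 rankJ Fi0.
have [_ _ [e2 [_ _ /(_ x Sx) v2]]] := system_rP oU sF oS si iU hyp Fs_ge0 rankJ Fi0.
rewrite (I1tildeE oU sF si iU hyp Fs_ge0 Sx v1) (I2tildeE oU sF si iU hyp Fs_ge0 Sx v2).
rewrite -muGt // in v1; rewrite -muGr // in v2.
rewrite (I1tildeE oU sG si iU hypG Gs_ge0 Sx v1) (I2tildeE oU sG si iU hypG Gs_ge0 Sx v2).
rewrite (gradE _ _ muGt) (gradE _ _ muGr) lambdaG //.
by split; rewrite exprMn !mulNr mulrN mulrA.
Qed.

End Rescaling.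

(** * Identification of the given pair and conclusion *)

(** Over an empty [Sigma] every form is vacuously a section and all Pfaffian systems coincide. A
    pair of distinct ones provides the point at which [system_t] and [system_r] are told apart. *)
Lemma isotropic_pair_nonempty (R : realType) (Sigma : set 'rV[R]_7)
    (i : 'rV[R]_7 -> 'rV[R]_8) M1 M2 :
  isotropic_pair Sigma i M1 M2 -> exists x, Sigma x.
Proof.
move=> [[[H1 _] _ _] [[H2 _] _ _] ne _]; apply: contrapT => nS; apply: ne.
have S0 x : ~ Sigma x by move=> Sx; apply: nS; exists x.
apply/seteqP; split=> eta _; [apply/H2|apply/H1]; split=> [j s x /S0//|x /S0//].
Qed.

Lemma and_iff_types (A6 A7 B6 B7 a0 a1 b0 b1 ab0 ab1 : Prop) :
  (A6 <-> a0) -> (A7 <-> a1) -> (B6 <-> b0) -> (B7 <-> b1) ->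
  (ab0 <-> a0 /\ b0) -> (ab1 <-> a1 /\ b1) ->
  [/\ A6 /\ B6 <-> ab0, A6 /\ B7 \/ A7 /\ B6 <-> a0 /\ b1 \/ a1 /\ b0 & A7 /\ B7 <-> ab1].
Proof. by move=> hA6 hA7 hB6 hB7 h0 h1; split; rewrite ?hA6 ?hA7 ?hB6 ?hB7 ?h0 ?h1. Qed.

Lemma or_and_swap (a0 a1 b0 b1 : Prop) : a0 /\ b1 \/ a1 /\ b0 <-> b0 /\ a1 \/ b1 /\ a0.
Proof. by split=> -[[? ?]|[? ?]]; [right|left|right|left]. Qed.

Theorem theorem3p3 (R : realType) (U : set 'rV[R]_8) (F : 'rV[R]_8 -> R)
    (Sigma : set 'rV[R]_7) (i : 'rV[R]_7 -> 'rV[R]_8)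
    (openU : open U) (smoothF : smooth_on U F)
    (param : nondegenerate_parametrization U F Sigma i)
    (hyp : hyperbolic F Sigma i)
    (Fs_ge0 : forall x, Sigma x -> 0 <= partial js F (i x)) :
  let I1 := fun x => I1tilde F (i x) in
  let I2 := fun x => I2tilde F (i x) in
  (forall M1 M2 : set ('rV[R]_7 -> 'rV[R]_7), isotropic_pair Sigma i M1 M2 ->
    [/\ monge_ampere_type Sigma M1 M2 <->
          (forall x, Sigma x -> I1 x = 0 /\ I2 x = 0),
        goursat_type Sigma M1 M2 <->
          ((forall x, Sigma x -> I1 x = 0) /\
           (forall x, Sigma x -> I2 x <> 0)) \/
          ((forall x, Sigma x -> I1 x <> 0) /\
           (forall x, Sigma x -> I2 x = 0))
      & generic_type Sigma M1 M2 <->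
          (forall x, Sigma x -> I1 x * I2 x <> 0)]) /\
  (forall phi : 'rV[R]_8 -> R, smooth_on U phi ->
    (forall x, Sigma x -> 0 < phi (i x)) ->
    let Fhat := fun w => phi w * F w in
    forall x, Sigma x ->
      I1tilde Fhat (i x) = phi (i x) ^+ 2 * I1 x /\
      I2tilde Fhat (i x) = phi (i x) ^+ 2 * I2 x).
Proof.
move=> I1 I2; have [[oS si] rankJ imi _] := param.
have iUF x (Sx : Sigma x) : U (i x) /\ F (i x) = 0.
  have : (i @` Sigma) (i x) by exists x.
  by rewrite imi.
have iU x (Sx : Sigma x) := (iUF x Sx).1; have Fi0 x (Sx : Sigma x) := (iUF x Sx).2.
split=> [M1 M2 pair|phi sphi phi0 Fhat x Sx]; last first.
  exact: (I_tilde_rescale openU smoothF sphi oS si iU hyp Fs_ge0 rankJ Fi0 phi0 Sx).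
have [x0 Sx0] := isotropic_pair_nonempty pair.
have [maxt _ [_ [t6 t7 _]]] := system_tP openU smoothF oS si iU hyp Fs_ge0 rankJ Fi0.
have [maxr _ [_ [r6 r7 _]]] := system_rP openU smoothF oS si iU hyp Fs_ge0 rankJ Fi0.
have ne := system_t_neq_r openU smoothF oS si iU hyp Fs_ge0 rankJ Fi0 Sx0.
have prodP : (forall x, Sigma x -> I1 x * I2 x <> 0) <->
    (forall x, Sigma x -> I1 x <> 0) /\ (forall x, Sigma x -> I2 x <> 0).
  split=> [H|[H1 H2] x Sx].
    by split=> x Sx E; apply: (H x Sx); rewrite E ?mul0r ?mulr0.
  by move/eqP; rewrite mulf_eq0 => /orP[/eqP/(H1 x Sx)|/eqP/(H2 x Sx)].
have zeroP : (forall x, Sigma x -> I1 x = 0 /\ I2 x = 0) <->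
    (forall x, Sigma x -> I1 x = 0) /\ (forall x, Sigma x -> I2 x = 0).
  by split=> [H|[H1 H2] x Sx]; split; try (move=> x /H[]//); [exact: H1|exact: H2].
have [_ _ M12 all] := pair.
suff [[E1 E2]|[E1 E2]] : (M1 = system_t F Sigma i /\ M2 = system_r F Sigma i) \/
    (M1 = system_r F Sigma i /\ M2 = system_t F Sigma i).
- by rewrite E1 E2; exact: and_iff_types t6 t7 r6 r7 zeroP prodP.
- have [h1 h2 h3] := and_iff_types r6 r7 t6 t7
    (iff_trans zeroP (and_comm _ _)) (iff_trans prodP (and_comm _ _)).
  rewrite E1 E2; split; [exact: h1| |exact: h3].
  exact: iff_trans h2 (or_and_swap _ _ _ _).
(* By hypothesis the pair contains every maximally isotropic system of rank two, so two distinct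
   ones exhaust it, in one order or the other. *)
have [Et|Et] := all _ maxt; have [Er|Er] := all _ maxr.
- by case: (ne (etrans Et (esym Er))).
- by left; split; [exact: esym Et|exact: esym Er].
- by right; split; [exact: esym Er|exact: esym Et].
- by case: (ne (etrans Et (esym Er))).
Qed.
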